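(* Let $r\ge 2$ and $1\le i\le r$ be integers, $q$ complex with $|q|<1$, and $z$ a nonzero complex number such that no denominator below vanishes. Then \begin{align*} \sum_{k\in\Lambda^{r-1}}\frac{(-q^{1-2k_1}/z;q^2)_{k_1}\,q^{2\sum_{j=1}^{r-1}k_j^2+2\sum_{j=i}^{r-1}k_j}}{(zq^2;q^2)_{k_{r-1}}\prod_{j=1}^{r-2}(q^2;q^2)_{k_j-k_{j+1}}}z^{2\sum_{j=1}^{r-1}k_j} ={}&\frac{(-zq,1/z;q^2)_\infty}{(z^2q^2,1/z^2;q^2)_\infty}(q^{4r};q^{4r})_\infty\\ &\times\Big[(z^{2r}q^{4r+1-2i},z^{-2r}q^{2i-1};q^{4r})_\infty+z^{2i-1-2r}(z^{2r}q^{2i-1},z^{-2r}q^{4r+1-2i};q^{4r})_\infty\Big]. \end{align*}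
   Context: For complex $x$ and $k\in\mathbb Z\cup\{\infty\}$ the $q$-shifted factorial is $(x;q)_0=1$, $(x;q)_k=\prod_{j=1}^k(1-xq^{j-1})$ for $k>0$ (including $k=\infty$), and $(x;q)_k=\prod_{j=1}^{-k}(1-xq^{-j})^{-1}$ for $k<0$; $(x_1,\dots,x_m;q)_k=\prod_l(x_l;q)_k$. For $r\ge2$, $k=(k_1,\dots,k_{r-1})$ and $\Lambda^{r-1}=\{k\in\mathbb Z^{r-1}:\infty>k_1\ge\dots\ge k_{r-1}>-\infty\}$. Empty products are $1$, empty sums $0$. *)

(* Defs.v *)
From HB Require Import structures.
From mathcomp Require Import all_boot all_order all_algebra finmap.
From mathcomp Require Import all_classical all_reals topology normedtype.
From mathcomp Require Import summability.
From mathcomp Require Export complex.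

Set Implicit Arguments.
Unset Strict Implicit.
Unset Printing Implicit Defensive.

Import Order.TTheory GRing.Theory Num.Theory.
Import numFieldNormedType.Exports.

Local Open Scope classical_set_scope.
Local Open Scope ring_scope.

Definition qpoch (F : fieldType) (x q : F) (k : int) : F :=
  match k with
  | Posz n => \prod_(1 <= j < n.+1) (1 - x * q ^+ j.-1)
  | Negz n => \prod_(1 <= j < n.+2) (1 - x * q ^- j)^-1
  end.

(* For k < 0, (x; q)_k is a product of reciprocals; since 0^-1 = 0 here, that
   these reciprocals exist has to be said separately.  Vacuous for k >= 0. *)
Definition qpoch_wd (F : fieldType) (x q : F) (k : int) : Prop :=
  forall j : nat, (0 < j)%N -> j%:Z <= - k -> 1 - x * q ^- j != 0.

Definition qpoch_inf (K : numFieldType) (x q : K) : K :=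
  lim ((fun n : nat => \prod_(1 <= j < n.+1) (1 - x * q ^+ j.-1)) @ \oo).

Definition qpoch_inf2 (K : numFieldType) (x y q : K) : K :=
  qpoch_inf x q * qpoch_inf y q.

(* Nonincreasing n-tuples of integers, of either sign. *)
Definition Lambda (n : nat) : choiceType :=
  {k : n.-tuple int | sorted >=%R k}.

(* The components are numbered from 1: k_1 >= ... >= k_n. *)
Definition part (n : nat) (k : Lambda n) (j : nat) : int :=
  nth 0 (val k : n.-tuple int) j.-1.

(* Unconditional summation: the finite partial sums converge to s along the
   finite subsets of I directed by inclusion. *)
Definition has_sum (I : choiceType) (K : numFieldType) (f : I -> K) (s : K)
  : Prop := partial_sum f @ totally --> s.

(* Main.v *)
Require Import Defs.
From mathcomp Require Import all_boot all_order all_algebra finmap.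
From mathcomp Require Import all_classical all_reals topology normedtype.
From mathcomp Require Import summability sequences exp.
From mathcomp Require Import zify ring lra.

Set Implicit Arguments.
Unset Strict Implicit.
Unset Printing Implicit Defensive.

Import Order.TTheory GRing.Theory Num.Theory.
Import numFieldNormedType.Exports Normc.

Local Open Scope classical_set_scope.
Local Open Scope fset_scope.
Local Open Scope ring_scope.

(* Put [Q = q^2], [u_n = z^n q^(n^2)], and let
   [k_N(n) = 1 / ((Q; Q)_(N-n) (z^2 Q; Q)_(N+n))] be the kernel of Bailey's
   transform, so that [(alpha, beta)] is a Bailey pair when
   [beta_N = sum_n alpha_n k_N(n)], the sum being over all integers.  The multiple
   series is summed from the inside out: each variable turns one Bailey pair into
   the next, and all the bilateral sums that occur are shifts or reflections of
   unilateral ones: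
   - [sum_s u_s^2 k_s(n) / (Q; Q)_(N-s) = u_n^2 k_N(n)], by which a summation over
     an inner variable multiplies [alpha_n] by [u_n^2], is q-Chu-Vandermonde;
   - [sum_s (-zq; Q)_s u_s k_s(n) = (-zq; Q)_oo / (z^2 Q; Q)_oo u_n], for the
     outermost variable, is the 1phi1 sum;
   - the initial pair, with [beta_N] a multiple of [1 / (zQ; Q)_N], is a limiting
     case of the very-well-poised 6phi5 sum.
   The factor [Q^(k_j)], present for [j >= i], is absorbed by a summation by parts:
   if [alpha_n = g_n - z^2 Q^(2n-1) g_(n-1)] belongs to [beta_s], then
   [Q^n g_n - Q^(n-1) g_(n-1)] belongs to [Q^s beta_s].  What remains after the
   outermost summation is a combination of two theta series, which Jacobi's
   triple product evaluates.  Gaussian bounds on the terms give the absolute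
   convergence that all the rearrangements rest on. *)

#[local] Existing Instance totally_filter.

#[local] Arguments qpoch : simpl never.

(** * The modulus of a complex number *)

Section Modulus.
Variable R : realType.
Implicit Types x y : R[i].

Lemma normcE x : `|x| = (normc x)%:C%C.
Proof. by []. Qed.

Lemma normc_ge0 x : 0 <= normc x.
Proof. by case: x => a b; exact: sqrtr_ge0. Qed.

(* [le_normcD] and [normcN] are about the type [Rcomplex R], not [R[i]]. *)
Lemma ler_normcD x y : normc (x + y) <= normc x + normc y.
Proof. exact: le_normcD. Qed.

Lemma normc_opp x : normc (- x) = normc x.
Proof. exact: normcN. Qed.

Lemma normcB_ge x y : normc x - normc y <= normc (x - y).
Proof. by rewrite lerBlDr -{1}[x](subrK y) ler_normcD. Qed.

Lemma normc_gt0 x : (0 < normc x) = (x != 0).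
Proof. by rewrite -ltcR -normcE normr_gt0. Qed.

Lemma normcX x n : normc (x ^+ n) = normc x ^+ n.
Proof. by elim: n => [|n IH]; rewrite ?normc1 // !exprS normcM IH. Qed.

Lemma normcXz x (n : int) : normc (x ^ n) = normc x ^ n.
Proof. by case: n => n; rewrite ?NegzE -?exprnN ?normcV -?exprnP ?normcX. Qed.

Lemma ler_normc_sum (I : Type) (r : seq I) (f : I -> R[i]) :
  normc (\sum_(i <- r) f i) <= \sum_(i <- r) normc (f i).
Proof.
elim: r => [|i r IH]; first by rewrite !big_nil normc0.
by rewrite !big_cons (le_trans (ler_normcD _ _)) // lerD2l.
Qed.

Lemma normc_real (r : R) : normc r%:C%C = `|r|.
Proof. by rewrite /= expr0n addr0 sqrtr_sqr. Qed.

Lemma normr_Re_le x : `|complex.Re x| <= normc x.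
Proof. by rewrite -lecR -normcE normc_ge_Re. Qed.

Lemma normr_Im_le x : `|complex.Im x| <= normc x.
Proof.
case: x => a b /=; rewrite -sqrtr_sqr ler_wsqrtr // lerDr; exact: sqr_ge0.
Qed.

Lemma cvg_normc (T : Type) (F : set_system T) {FF : Filter F}
    (u : T -> (R[i] : numFieldType)) (l : R[i]) :
  (forall e : R, 0 < e -> \forall t \near F, normc (u t - l) < e) ->
  u @ F --> (l : (R[i] : numFieldType)).
Proof.
move=> ul; apply/cvgrPdistC_lt => e e0.
have eE : e = (complex.Re e)%:C%C by rewrite RRe_real // gtr0_real.
have /ul : 0 < complex.Re e by rewrite -ltcR -eE.
by apply: filterS => t; rewrite eE normcE ltcR.
Qed.

Lemma normc_cvg (T : Type) (F : set_system T) {FF : Filter F}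
    (u : T -> (R[i] : numFieldType)) (l : R[i]) (e : R) :
  u @ F --> (l : (R[i] : numFieldType)) -> 0 < e ->
  \forall t \near F, normc (u t - l) < e.
Proof.
move=> /cvgrPdistC_lt ul e0; have /ul : 0 < e%:C%C by rewrite ltcR.
by apply: filterS => t; rewrite normcE ltcR.
Qed.

End Modulus.

(** * Unconditional sums *)

Lemma num_cvg_unique (K : numFieldType) (T : Type) (F : set_system T)
    {FF : ProperFilter F} (u : T -> K) (l m : K) :
  u @ F --> l -> u @ F --> m -> l = m.
Proof. exact: (@cvg_unique K^o (@norm_hausdorff K K^o)). Qed.

Section HasSum.
Variable K : numFieldType.

Lemma partial_sumE (I : choiceType) (f : I -> K) (F : {fset I}) :
  partial_sum f F = \sum_(i <- F) f i.
Proof. by rewrite /partial_sum big_seq_fsetE. Qed.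

Lemma has_sumP (I : choiceType) (f : I -> K) s :
  has_sum f s <-> forall e : K, 0 < e -> exists A : {fset I},
    forall F : {fset I}, A `<=` F -> `|\sum_(i <- F) f i - s| < e.
Proof.
split=> [/cvgrPdistC_lt fs e /fs [A _ hA]|fs].
  by exists A => F /hA; rewrite /= partial_sumE.
apply/cvgrPdistC_lt => e /fs [A hA]; exists A => // F /hA.
by rewrite /= partial_sumE.
Qed.

Section Linearity.
Variable I : choiceType.
Implicit Types (f g : I -> K) (s t : K).

Lemma eq_has_sum f g s : f =1 g -> has_sum f s -> has_sum g s.
Proof. by move=> /funext ->. Qed.

Lemma has_sumD f g s t :
  has_sum f s -> has_sum g t -> has_sum (fun i => f i + g i) (s + t).
Proof.
move=> fs gt; rewrite /has_sum.
rewrite (_ : partial_sum _ = partial_sum f \+ partial_sum g); first exact: cvgD.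
by apply/funext => F; rewrite /= !partial_sumE big_split.
Qed.

Lemma has_sumZ c f s : has_sum f s -> has_sum (fun i => c * f i) (c * s).
Proof.
move=> fs; rewrite /has_sum.
rewrite (_ : partial_sum _ = cst c \* partial_sum f).
  by apply: cvgM; [exact: cvg_cst|].
by apply/funext => F; rewrite /= !partial_sumE mulr_sumr.
Qed.

#[global] Arguments has_sumZ c {f s} _.

Lemma has_sumB f g s t :
  has_sum f s -> has_sum g t -> has_sum (fun i => f i - g i) (s - t).
Proof.
move=> fs /(has_sumZ (-1)) gt; rewrite -mulN1r.
by apply: eq_has_sum (has_sumD fs gt) => i; rewrite mulN1r.
Qed.

Lemma has_sum_unique f s t : has_sum f s -> has_sum f t -> s = t.
Proof. exact: num_cvg_unique. Qed.

Lemma has_sum_single f i0 : (forall i, i != i0 -> f i = 0) -> has_sum f (f i0).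
Proof.
move=> f0; apply/has_sumP => e e0; exists [fset i0] => F; rewrite fsub1set => iF.
rewrite (big_fsetD1 i0) //= big_seq big1 ?addr0 ?subrr ?normr0 // => i.
by rewrite !inE => /andP[/f0].
Qed.

End Linearity.

Lemma has_sum_reindex (I J : choiceType) (h : I -> J) (h' : J -> option I)
    (f : J -> K) s :
  pcancel h h' -> ocancel h' h -> (forall j, h' j = None -> f j = 0) ->
  has_sum f s -> has_sum (f \o h) s.
Proof.
move=> hK h'K f0 /has_sumP fs; apply/has_sumP => e /fs [A hA].
exists [fset i in pmap h' A] => F AF; have inj := pcan_inj hK.
have -> : \sum_(i <- F) (f \o h) i = \sum_(j <- [fset h i | i in F]) f j.
  by rewrite big_imfset //= => x y _ _ /inj.
rewrite (big_fset_incl _ (fsubsetUl _ A)).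
  by apply: hA; apply: fsubsetUr.
move=> j; rewrite in_fsetU => /orP[->//|jA] jF.
case hj : (h' j) => [i|]; last exact: f0.
case/negP: jF; have hij : h i = j by have := h'K j; rewrite hj.
apply/imfsetP; exists i => //=; apply: (fsubsetP AF).
by rewrite in_fset /= mem_pmap; apply/mapP; exists j.
Qed.

Lemma has_sum_reindex_bij (I J : choiceType) (h : I -> J) (h' : J -> I)
    (f : J -> K) s :
  cancel h h' -> cancel h' h -> has_sum f s -> has_sum (f \o h) s.
Proof.
move=> hK h'K; apply: (has_sum_reindex (h' := Some \o h')) => // i.
by rewrite /= hK.
Qed.

Lemma has_sum_iter (I J : choiceType) (f : I * J -> K) (g : I -> K) s :
  has_sum f s -> (forall i, has_sum (fun j => f (i, j)) (g i)) -> has_sum g s.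
Proof.
move=> /has_sumP fs fg; apply/has_sumP => e e0.
have [P hP] := fs _ (divr_gt0 e0 (ltr0n K 2)).
exists [fset p.1 | p in P] => A PA.
have : partial_sum (fun j => \sum_(i <- A) f (i, j)) @ totally
    --> \sum_(i <- A) g i.
  rewrite (_ : partial_sum _ = (fun B => \sum_(i <- A) partial_sum
    (fun j => f (i, j)) B)).
    by apply: cvg_big => [|i _]; [exact: add_continuous|exact: fg].
  apply/funext => B; rewrite partial_sumE exchange_big /=.
  by under eq_bigr do rewrite -partial_sumE.
move=> /has_sumP /(_ _ (divr_gt0 e0 (ltr0n K 2))) [B hB].
have := hB _ (fsubsetUl B [fset p.2 | p in P]); rewrite exchange_big /=.
set D := B `|` _; set x := \sum_(i <- A) \sum_(j <- D) _.
have /hP : P `<=` [fset ((i, j) : (I * J)%type) | i in A, j in D].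
  apply/fsubsetP => -[i j] ijP; apply/imfset2P; exists i.
    by apply: (fsubsetP PA); apply/imfsetP; exists (i, j).
  exists j => //; rewrite inE; apply/orP; right.
  by apply/imfsetP; exists (i, j).
rewrite big_imfset2 /=; last by move=> [? ?] [? ?] _ _ [-> ->].
rewrite -/x distrC => xs xg; rewrite [e](splitr e) distrC.
by rewrite (le_lt_trans (ler_distD x _ _)) // ltrD // distrC.
Qed.

Lemma has_sum_shift (f : int -> K) s (k : int) :
  has_sum f s -> has_sum (fun n => f (n + k)) s.
Proof. exact: (has_sum_reindex_bij (addrK k) (subrK k)). Qed.

Lemma has_sum_opp (f : int -> K) s (k : int) :
  has_sum f s -> has_sum (fun n => f (k - n)) s.
Proof. by apply: (@has_sum_reindex_bij _ _ _ (fun n => k - n)) => n; ring. Qed.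

Lemma has_sum_telescope (f h : int -> K) s t : has_sum f s -> has_sum h t ->
  has_sum (fun n => f n - h n + h (n + 1)) s.
Proof.
move=> fs ht; rewrite -[s](subrK t).
exact: has_sumD (has_sumB fs ht) (has_sum_shift 1 ht).
Qed.

End HasSum.

(** * Absolute convergence *)

Section BoundedSums.
Variable R : realType.
Local Notation C := (R[i] : numFieldType).

Lemma big_fset_subset (V : nmodType) (I : choiceType) (A F : {fset I})
    (f : I -> V) : A `<=` F ->
  \sum_(i <- F) f i = \sum_(i <- A) f i + \sum_(i <- F `\` A) f i.
Proof.
move=> /fsubsetP AF; rewrite (big_fsetID _ (mem A) F) /=.
congr (_ + _); apply: eq_fbigl => i; rewrite !inE /=; last exact: andbC.
by apply/andP/idP => [[]|iA] //; split=> //; apply: AF.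
Qed.

Lemma ler_sum_fset (I : choiceType) (A F : {fset I}) (b : I -> R) :
  (forall i, 0 <= b i) -> A `<=` F -> \sum_(i <- A) b i <= \sum_(i <- F) b i.
Proof. by move=> b0 /big_fset_subset ->; rewrite lerDl sumr_ge0. Qed.

Definition bounded_sums (I : choiceType) (b : I -> R) :=
  exists B, forall F : {fset I}, \sum_(i <- F) b i <= B.

Lemma bounded_sums_le (I : choiceType) (b c : I -> R) :
  (forall i, b i <= c i) -> bounded_sums c -> bounded_sums b.
Proof. by move=> bc [B cB]; exists B => F; apply: le_trans (cB F); apply: ler_sum. Qed.

Lemma bounded_sumsZ (I : choiceType) c (b : I -> R) : 0 <= c ->
  bounded_sums b -> bounded_sums (fun i => c * b i).
Proof.
by move=> c0 [B bB]; exists (c * B) => F; rewrite -mulr_sumr ler_wpM2l.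
Qed.

Lemma bounded_sums_inj (I J : choiceType) (h : I -> J) (b : J -> R) :
  injective h -> bounded_sums b -> bounded_sums (b \o h).
Proof.
move=> inj [B bB]; exists B => F; apply: le_trans (bB [fset h i | i in F]).
by rewrite big_imfset //= => x y _ _ /inj.
Qed.

Lemma bounded_sumsM (I J : choiceType) (b : I -> R) (c : J -> R) :
  (forall i, 0 <= b i) -> (forall j, 0 <= c j) ->
  bounded_sums b -> bounded_sums c ->
  bounded_sums (fun p : I * J => b p.1 * c p.2).
Proof.
move=> b0 c0 [B bB] [D cD]; exists (B * D) => P.
pose A := [fset p.1 | p in P]; pose E := [fset p.2 | p in P].
apply: (@le_trans _ _ (\sum_(p <- [fset ((i, j) : (I * J)%type) | i in A, j in E])
    b p.1 * c p.2)).
  apply: ler_sum_fset => [p|]; first by rewrite mulr_ge0.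
  apply/fsubsetP => -[i j] ijP; apply/imfset2P.
  by exists i; [|exists j] => //; apply/imfsetP; exists (i, j).
rewrite big_imfset2 /=; last by move=> [? ?] [? ?] _ _ [-> ->].
by rewrite -big_distrlr /= ler_pM // sumr_ge0.
Qed.

Section OneIndex.
Variable I : choiceType.
Implicit Types (b : I -> R) (f g : I -> C).

Lemma bounded_sums_sup b : (forall i, 0 <= b i) -> bounded_sums b ->
  exists s : R, (forall F : {fset I}, \sum_(i <- F) b i <= s) /\
    forall e, 0 < e -> exists A : {fset I},
      forall F : {fset I}, A `<=` F -> s - e < \sum_(i <- F) b i.
Proof.
move=> b0 [B bB]; pose E := range (fun F : {fset I} => \sum_(i <- F) b i).
have supE : has_sup E.
  by split; [exists (\sum_(i <- fset0) b i), fset0|exists B => _ [F _ <-]].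
exists (sup E); split=> [F|e e0]; first by apply: ub_le_sup; [case: supE|exists F].
have [_ [A _ <-] hA] := sup_adherent e0 supE.
by exists A => F AF; apply: lt_le_trans hA (ler_sum_fset b0 AF).
Qed.

Lemma bounded_sums_tail b (e : R) :
  (forall i, 0 <= b i) -> bounded_sums b -> 0 < e ->
  exists A : {fset I}, forall F, A `<=` F -> \sum_(i <- F `\` A) b i <= e.
Proof.
move=> b0 hb e0; have [s [b_le /(_ e e0) [A hA]]] := bounded_sums_sup b0 hb.
exists A => F AF; have := b_le F; have := hA A (fsubset_refl A).
by rewrite (big_fset_subset b AF); lra.
Qed.

Lemma has_sum_ge0 b : (forall i, 0 <= b i) -> bounded_sums b ->
  exists s : C, has_sum (fun i => (b i)%:C%C : C) s.
Proof.
move=> b0 hb; have [s [b_le hs]] := bounded_sums_sup b0 hb.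
exists s%:C%C; apply: cvg_normc => e /hs [A hA]; exists A => // F /hA lt_sum.
rewrite /= partial_sumE -rmorph_sum -rmorphB normc_real.
by rewrite ler0_norm ?subr_le0 ?b_le //; lra.
Qed.

(* [Re f = (|f| + Re f) - |f|] is a difference of nonnegative families. *)
Lemma dominated_has_sum b f : bounded_sums b ->
  (forall i, normc (f i) <= b i) -> exists s, has_sum f s.
Proof.
move=> hb fb; have nf0 i := normc_ge0 (f i).
have part (g : R[i] -> R) : (forall x, `|g x| <= normc x) ->
    exists s, has_sum (fun i => (g (f i))%:C%C : C) s.
  move=> gn; have gf i : - normc (f i) <= g (f i) <= normc (f i).
    by rewrite -ler_norml.
  have [s hs] := has_sum_ge0 nf0 (bounded_sums_le fb hb).
  have [i||t ht] := @has_sum_ge0 (fun i => normc (f i) + g (f i)).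
  - by have /andP[] := gf i; lra.
  - apply: bounded_sums_le (bounded_sumsZ (ler0n R 2) hb) => i.
    by have /andP[] := gf i; have := fb i; lra.
  exists (t - s); apply: eq_has_sum (has_sumB ht hs) => i.
  by rewrite -rmorphB /= addrC addKr.
have [s hs] := part _ (@normr_Re_le R); have [t ht] := part _ (@normr_Im_le R).
exists (s + 'i%C * t); apply: eq_has_sum (has_sumD hs (has_sumZ 'i%C ht)) => i.
by rewrite -complexE.
Qed.

Lemma has_sum_tail b (e : R) :
  (forall i, 0 <= b i) -> bounded_sums b -> 0 < e ->
  exists A : {fset I}, forall f s, (forall i, normc (f i) <= b i) ->
    has_sum f s -> normc (s - \sum_(i <- A) f i) <= e.
Proof.
move=> b0 hb e0; have [A hA] := bounded_sums_tail b0 hb e0.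
exists A => f s fb fs; apply/ler_addgt0Pr => d d0.
have [E _ /(_ (A `|` E) (fsubsetUr _ _))] := normc_cvg fs d0.
rewrite /= partial_sumE (big_fset_subset f (fsubsetUl A E)).
set x := \sum_(i <- A) f i; set y := \sum_(i <- _) f i => fs_lt.
have -> : s - x = y - (x + y - s) by ring.
rewrite (le_trans (ler_normcD _ _)) // normc_opp lerD //; last exact: ltW.
rewrite /y (le_trans (ler_normc_sum _ _)) // (le_trans _ (hA _ (fsubsetUl A E))) //.
exact: ler_sum.
Qed.

Lemma has_sum_dominated_cvg (T : Type) (F : set_system T) {FF : ProperFilter F}
    b (f : T -> I -> C) g (s : T -> C) t :
  bounded_sums b -> (forall x i, normc (f x i) <= b i) ->
  (forall i, f x i @[x --> F] --> g i) ->
  (forall x, has_sum (f x) (s x)) -> has_sum g t -> s @ F --> t.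
Proof.
move=> hb fb fg fs gt; apply: cvg_normc => e e0.
have gb i : normc (g i) <= b i.
  apply/ler_addgt0Pr => d /(normc_cvg (fg i)) h.
  have [x /= fgx] := filter_ex h; rewrite -[g i](subrK (f x i)) addrC.
  by rewrite (le_trans (ler_normcD _ _)) // lerD // -normc_opp opprB ltW.
have b0 i : 0 <= b i by apply: le_trans (gb i); apply: normc_ge0.
have [A hA] := has_sum_tail b0 hb (divr_gt0 e0 (ltr0n R 4)).
have : (\sum_(i <- A) f x i) @[x --> F] --> \sum_(i <- A) g i.
  by apply: cvg_big => [|i _]; [exact: add_continuous|exact: fg].
move/normc_cvg=> /(_ _ (divr_gt0 e0 (ltr0n R 4))); apply: filterS => x fgA.
have fA := hA _ _ (fb x) (fs x); have gA := hA _ _ gb gt.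
set u := \sum_(i <- A) f x i in fgA fA; set v := \sum_(i <- A) g i in fgA gA.
have -> : s x - t = (s x - u) + (u - v) - (t - v) by ring.
have := ler_normcD (s x - u + (u - v)) (- (t - v)).
by have := ler_normcD (s x - u) (u - v); rewrite normc_opp; lra.
Qed.

End OneIndex.

Lemma has_sum_exchange (I J : choiceType) (b : I * J -> R) (f : I -> J -> C) g h :
  bounded_sums b -> (forall i j, normc (f i j) <= b (i, j)) ->
  (forall i, has_sum (f i) (g i)) -> (forall j, has_sum (f^~ j) (h j)) ->
  exists s, has_sum g s /\ has_sum h s.
Proof.
move=> hb fb fg fh.
have [[i j] |s hs] := @dominated_has_sum _ b (fun p => f p.1 p.2) hb.
  exact: fb.
exists s; split; first exact: has_sum_iter hs fg.
pose swap (A B : choiceType) (p : A * B) := (p.2, p.1).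
apply: (has_sum_iter (f := fun p : J * I => f p.2 p.1)) fh.
by apply: (has_sum_reindex_bij (h := @swap J I) (h' := @swap I J)) hs => -[].
Qed.

End BoundedSums.

(** * Finite q-shifted factorials *)

Section QPochhammer.
Variables (F : fieldType) (Q : F).
Implicit Types (x : F) (n : int).

Lemma qpoch_natE x (n : nat) : qpoch x Q n = \prod_(j < n) (1 - x * Q ^+ j).
Proof. by rewrite /qpoch big_add1 /= big_mkord. Qed.

Lemma qpoch0 x : qpoch x Q 0 = 1.
Proof. by rewrite (qpoch_natE _ 0) big_ord0. Qed.

Lemma qpoch_wd_nat x (n : nat) : qpoch_wd x Q n.
Proof. by move=> j j0 jn; lia. Qed.

Lemma qpoch_wd_ge x m n : m <= n -> qpoch_wd x Q m -> qpoch_wd x Q n.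
Proof. by move=> mn wd j j0 jn; apply: wd => //; lia. Qed.

Lemma qpochS x n : qpoch_wd x Q n ->
  qpoch x Q (n + 1) = qpoch x Q n * (1 - x * Q ^ n).
Proof.
case: n => n wd; first by rewrite -PoszD addn1 /qpoch big_nat_recr.
have -> : Negz n + 1 = - n%:Z by rewrite NegzE; lia.
rewrite -[Q ^ Negz n]/(Q ^- n.+1) {2}/qpoch big_nat_recr //= divfK; last first.
  by apply: wd; rewrite // NegzE; lia.
case: n {wd} => [|n]; last by rewrite -NegzE.
by rewrite oppr0 qpoch0 big_geq.
Qed.

Lemma qpoch_neq0 x (n : nat) : (forall j, 1 - x * Q ^+ j != 0) ->
  qpoch x Q n != 0.
Proof. by move=> h; rewrite qpoch_natE; apply/prodf_neq0 => i _; apply: h. Qed.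

Hypothesis Q0 : Q != 0.

Lemma qpochD x m (n : nat) : qpoch_wd x Q m ->
  qpoch x Q (m + n%:Z) = qpoch x Q m * qpoch (x * Q ^ m) Q n.
Proof.
move=> wd; elim: n => [|n IH]; first by rewrite addr0 qpoch0 mulr1.
rewrite -addn1 PoszD addrA !qpochS; first by rewrite IH expfzDr // !mulrA.
  exact: qpoch_wd_nat.
by apply: qpoch_wd_ge wd; lia.
Qed.

Lemma qpoch_front x (n : nat) :
  qpoch x Q (n%:Z + 1) = (1 - x) * qpoch (x * Q) Q n.
Proof.
have := @qpochD x 1 n (@qpoch_wd_nat x 1); rewrite expr1z addrC => ->.
by rewrite (qpoch_natE _ 1) big_ord1 expr0 mulr1.
Qed.

Definition qregular x := forall n, 1 - x * Q ^ n != 0.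

Lemma qregular_nat x (j : nat) : qregular x -> 1 - x * Q ^+ j != 0.
Proof. by move/(_ j). Qed.

Lemma qregular_wd x n : qregular x -> qpoch_wd x Q n.
Proof. by move=> h j _ _; rewrite exprnN. Qed.

Lemma qregularM x n : qregular x -> qregular (x * Q ^ n).
Proof. by move=> h m; rewrite -mulrA -expfzDr. Qed.

Lemma qregularV x : qregular x -> qregular x^-1.
Proof.
move=> h n; have := h (- n); rewrite -invr_expz; apply: contra_neq => /eqP.
by rewrite subr_eq0 => /eqP e; rewrite -[x]invrK -invfM -e invr1 subrr.
Qed.

Lemma qregular_sqr x : qregular (x ^+ 2) -> qregular x.
Proof.
move=> h n; have := h (n + n); apply: contra_neq => /eqP.
rewrite expfzDr // subr_eq0 => /eqP e.
by rewrite expr2 mulrACA -e mulr1 subrr.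
Qed.

Lemma qregular_neq0 x n : qregular x -> qpoch x Q n != 0.
Proof.
move=> h; case: n => n; first by apply: qpoch_neq0 => j; apply: qregular_nat.
rewrite /qpoch big_add1 /= big_mkord; apply/prodf_neq0 => i _.
by rewrite invr_eq0 exprnN.
Qed.

Lemma qpochVS x n : qregular x ->
  (qpoch x Q n)^-1 = (qpoch x Q (n + 1))^-1 * (1 - x * Q ^ n).
Proof.
move=> h; rewrite qpochS; last exact: qregular_wd.
by rewrite invfM mulrAC -mulrA mulfV // mulr1.
Qed.

Lemma qpoch_oppM x (n : nat) : qpoch_wd x Q (- n%:Z) ->
  qpoch x Q (- n%:Z) * qpoch (x * Q ^ (- n%:Z)) Q n = 1.
Proof. by move=> wd; rewrite -qpochD // addNr qpoch0. Qed.

End QPochhammer.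

Section Reflection.
Variables (F : fieldType) (q : F).
Hypothesis q0 : q != 0.
Local Notation Q := (q ^+ 2).
Implicit Types (x : F) (n : int).

Lemma qbase_neq0 : Q != 0.
Proof. by rewrite expf_neq0. Qed.

Lemma qbase_exprz n : Q ^ n = q ^ (2 * n).
Proof. by rewrite exprnP exprz_exp. Qed.

Lemma qpoch_factor_reflect x n : x != 0 ->
  1 - Q / x * Q ^ n = - (q ^ (2 * (n + 1)) / x) * (1 - x * Q ^ (- (n + 1))).
Proof.
move=> x0; rewrite -invr_expz !qbase_exprz (_ : 2 * (n + 1) = 2 * n + 2); last by ring.
have := expfz_neq0 (2 * n) q0; rewrite expfzDr //.
by move: (q ^ _) => y y0; field; rewrite x0 q0 y0.
Qed.

Lemma qpoch_opp_reflect x (n : nat) : x != 0 -> qpoch_wd x Q (- n%:Z) ->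
  qpoch x Q (- n%:Z) * qpoch (Q / x) Q n
  = (- x) ^ (- n%:Z) * q ^ (n%:Z ^+ 2 + n%:Z).
Proof.
move=> x0; elim: n => [|n IH] wd.
  by rewrite oppr0 !qpoch0 expr0n addr0 !expr0z mulr1.
have eS : n.+1%:Z = n%:Z + 1 by lia.
rewrite eS in wd *; have wdn : qpoch_wd x Q (- n%:Z) by apply: qpoch_wd_ge wd; lia.
have := IH wdn; have -> : - n%:Z = - (n%:Z + 1) + 1 by ring.
rewrite (qpochS wd) => {}IH.
rewrite qpochS; last exact: qpoch_wd_nat.
rewrite qpoch_factor_reflect //.
have -> : forall a b c d : F, a * (b * (c * d)) = a * d * b * c by move=> *; ring.
rewrite IH.
rewrite (_ : (n%:Z + 1) ^+ 2 + (n%:Z + 1) = (n%:Z ^+ 2 + n%:Z) + 2 * (n%:Z + 1));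
  last by ring.
rewrite (expfzDr (n%:Z ^+ 2 + n%:Z) _ q0).
rewrite (expfzDr (- (n%:Z + 1)) 1) ?oppr_eq0 // expr1z.
by move: ((- x) ^ _) (q ^ _) (q ^ _) => *; field.
Qed.

Lemma qpoch_reflect x n : x != 0 ->
  qpoch_wd x Q n -> qpoch_wd (Q / x) Q (- n) ->
  qpoch x Q n * qpoch (Q / x) Q (- n) = (- x) ^ n * q ^ (n ^+ 2 - n).
Proof.
move=> x0; case: n => n wd wd'; last first.
  by rewrite NegzE in wd wd' *; rewrite opprK qpoch_opp_reflect // sqrrN.
have Qx0 : Q / x != 0 by rewrite mulf_neq0 ?invr_eq0 ?qbase_neq0.
have := qpoch_opp_reflect Qx0 wd'; rewrite invfM invrK mulVKf ?qbase_neq0 //.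
rewrite mulrC => ->.
have -> : - (Q / x) = q ^ (2 : int) * (- x)^-1 by rewrite invrN mulrN.
rewrite expfzMl exprz_inv exprz_exp opprK mulrAC -expfzDr // mulrC; congr (_ * _ ^ _).
by ring.
Qed.

Lemma qpoch_reverse_nat x (n : nat) : x != 0 ->
  qpoch (q ^ (2 - 2 * n%:Z) / x) Q n
  = (- x) ^ (- n%:Z) * q ^ (n%:Z - n%:Z ^+ 2) * qpoch x Q n.
Proof.
move=> x0; elim: n => [|n IH].
  by rewrite expr0n subrr oppr0 !qpoch0 !expr0z !mulr1.
rewrite (_ : n.+1%:Z = n%:Z + 1); last by lia.
rewrite qpoch_front ?qbase_neq0 //.
have -> : q ^ (2 - 2 * (n%:Z + 1)) / x * Q = q ^ (2 - 2 * n%:Z) / x.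
  by rewrite mulrAC exprnP -expfzDr //; congr (_ ^ _ / x); ring.
rewrite IH qpochS; last exact: qpoch_wd_nat.
have -> : 2 - 2 * (n%:Z + 1) = - (2 * n%:Z) by ring.
have -> : n%:Z + 1 - (n%:Z + 1) ^+ 2 = (n%:Z - n%:Z ^+ 2) - 2 * n%:Z by ring.
have nx0 : - x != 0 by rewrite oppr_eq0.
rewrite opprD (expfzDr _ _ nx0) (expfzDr (n%:Z - n%:Z ^+ 2) _ q0).
rewrite -[q ^ (- (2 * n%:Z))]invr_expz -[(- x) ^ (- 1)]invr_expz expr1z qbase_exprz.
have := expfz_neq0 (2 * n%:Z) q0.
move: (q ^ (2 * n%:Z)) ((- x) ^ _) (q ^ _) (qpoch _ _ _).
by move=> *; field; apply/and3P.
Qed.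

Lemma qpoch_wd_reverse x n : x != 0 ->
  qpoch_wd x Q n -> qpoch_wd (q ^ (2 - 2 * n) / x) Q n.
Proof.
move=> x0 wd j j0 jn; have [i iE] : exists i : nat, i%:Z = - n - j%:Z + 1.
  by exists (absz (- n - j%:Z + 1)); lia.
have := wd i ltac:(lia) ltac:(lia); apply: contra_neq.
rewrite !exprnN !qbase_exprz iE mulrAC -expfzDr // => /eqP.
have e0 := expfz_neq0 (2 - 2 * n + 2 * - j%:Z) q0.
rewrite subr_eq0 => /eqP /(congr1 ( *%R^~ x)); rewrite mul1r divfK // => ->.
by rewrite -expfzDr // [X in q ^ X](_ : _ = 0) ?expr0z ?subrr //; ring.
Qed.

Lemma qpoch_reverse_opp x (n : nat) : x != 0 -> qpoch_wd x Q (- n%:Z) ->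
  qpoch (q ^ (2 + 2 * n%:Z) / x) Q (- n%:Z)
  = (- x) ^ n%:Z * q ^ (- n%:Z - n%:Z ^+ 2) * qpoch x Q (- n%:Z).
Proof.
move=> x0 wd; set y := q ^ _ / x.
have yE m : y * Q ^ m = q ^ (2 * (n%:Z + 1 + m)) / x.
  by rewrite qbase_exprz mulrAC -expfzDr //; congr (_ ^ _ / x); ring.
have wdy : qpoch_wd y Q (- n%:Z).
  rewrite /y (_ : 2 + 2 * n%:Z = 2 - 2 * - n%:Z); last by ring.
  exact: qpoch_wd_reverse.
have := qpoch_oppM qbase_neq0 wdy; rewrite yE (_ : 2 * _ = 2); last by ring.
rewrite -[q ^ 2]/Q => yQ1; have := qpoch_opp_reflect x0 wd.
move/(congr1 ( *%R (qpoch y Q (- n%:Z)))); rewrite mulrCA yQ1 mulr1 => ->.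
have e0 := expfz_neq0 (n%:Z ^+ 2 + n%:Z) q0; have := expfz_neq0 n%:Z (_ : - x != 0).
rewrite oppr_eq0 => /(_ x0).
rewrite (_ : - n%:Z - n%:Z ^+ 2 = - (n%:Z ^+ 2 + n%:Z)); last by ring.
rewrite -!invr_expz; move: ((- x) ^ _) (q ^ _) (qpoch _ _ _) e0 => a b c b0 a0.
by field; rewrite a0 b0.
Qed.

Lemma qpoch_reverse x n : x != 0 -> qpoch_wd x Q n ->
  qpoch (q ^ (2 - 2 * n) / x) Q n = (- x) ^ (- n) * q ^ (n - n ^+ 2) * qpoch x Q n.
Proof.
move=> x0; case: n => n wd; first exact: qpoch_reverse_nat.
rewrite NegzE in wd *; have := qpoch_reverse_opp x0 wd.
by rewrite mulrN !opprK sqrrN.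
Qed.

End Reflection.

Section InverseQFactorial.
Variables (F : fieldType) (q : F).
Hypothesis q0 : q != 0.
Local Notation Q := (q ^+ 2).

Definition inv_qfact (n : int) : F := (qpoch Q Q n)^-1.

Lemma inv_qfact0 : inv_qfact 0 = 1.
Proof. by rewrite /inv_qfact qpoch0 invr1. Qed.

(* [(Q; Q)_n] contains the junk factor [0^-1 = 0] for [n < 0]. *)
Lemma inv_qfact_neg n : n < 0 -> inv_qfact n = 0.
Proof.
case: n => // n _; rewrite /inv_qfact /qpoch big_nat_recl //= expr1 mulfV.
  by rewrite subrr invr0 mul0r invr0.
exact: qbase_neq0.
Qed.

Hypothesis q_not_root : forall j, 1 - Q * Q ^+ j != 0.

Lemma inv_qfactS n : inv_qfact n = inv_qfact (n + 1) * (1 - Q ^ (n + 1)).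
Proof.
have [n0|n0] := ltP n 0.
  rewrite inv_qfact_neg //; have [n1|n1] := ltP (n + 1) 0.
    by rewrite inv_qfact_neg // mul0r.
  by rewrite (_ : n + 1 = 0) ?expr0z ?subrr ?mulr0 //; lia.
case: n n0 => // n _; rewrite expfzDr ?qbase_neq0 // expr1z [_ * Q]mulrC.
rewrite /inv_qfact qpochS; last exact: qpoch_wd_nat.
by rewrite invfM -mulrA mulVf ?mulr1 //; exact: q_not_root.
Qed.

Lemma inv_qfact_pred n : inv_qfact (n - 1) = inv_qfact n * (1 - Q ^ n).
Proof. by rewrite inv_qfactS subrK. Qed.

End InverseQFactorial.

(** * Infinite q-shifted factorials *)

Section NatSums.
Variable R : realType.

Lemma sum_geometric_le (p : R) n : 0 <= p < 1 -> \sum_(i < n) p ^+ i <= (1 - p)^-1.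
Proof.
move=> /andP[p0 p1]; rewrite -[leRHS]mul1r ler_pdivlMr ?subr_gt0 //.
by rewrite mulrC -opprB mulNr -subrX1 opprB gerBl exprn_ge0.
Qed.

Lemma fset_nat_bound (F : {fset nat}) :
  exists n, forall m, (n <= m)%N -> F `<=` [fset i in iota 0 m].
Proof.
exists (\max_(i <- F) i.+1)%N => m hm; apply/fsubsetP => i iF.
rewrite in_fset /= mem_iota /= add0n; apply: leq_trans hm.
by rewrite (big_rem i) //= leq_maxl.
Qed.

Lemma big_fset_iota (V : nmodType) (f : nat -> V) n :
  \sum_(i <- [fset i in iota 0 n]) f i = \sum_(i < n) f i.
Proof.
rewrite -(big_mkord xpredT) /index_iota subn0; apply: perm_big.
apply: uniq_perm; [exact: fset_uniq|exact: iota_uniq|].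
by move=> i; rewrite in_fset.
Qed.

Lemma bounded_sums_geometric (p : R) : 0 <= p < 1 ->
  bounded_sums (fun i : nat => p ^+ i).
Proof.
move=> hp; exists (1 - p)^-1 => F; have [n /(_ n (leqnn _)) hn] := fset_nat_bound F.
apply: le_trans (sum_geometric_le n hp); rewrite -big_fset_iota.
by apply: ler_sum_fset hn => i; rewrite exprn_ge0 //; case/andP: hp.
Qed.

Lemma bounded_sums_geometric_int (p : R) : 0 <= p < 1 ->
  bounded_sums (fun i : int => p ^+ absz i).
Proof.
move=> hp; have p0 : 0 <= p by case/andP: hp.
have inj : injective (fun i : int => (i < 0, absz i)).
  by move=> [a|a] [b|b] //= [] => [->|->].
have : bounded_sums (fun x : bool * nat => 1 * p ^+ x.2).
  apply: (bounded_sumsM (b := fun=> 1) (c := GRing.exp p)) => // [n||].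
  - exact: exprn_ge0.
  - exists (\sum_(i <- [fset true; false]) 1) => F.
    by apply: ler_sum_fset => //; apply/fsubsetP => -[]; rewrite !inE.
  - exact: bounded_sums_geometric.
move/(bounded_sums_inj inj); apply: bounded_sums_le => i /=.
by rewrite mul1r.
Qed.

Lemma has_sum_series (K : numFieldType) (f : nat -> K) s :
  has_sum f s -> (\sum_(i < n) f i) @[n --> \oo] --> s.
Proof.
move=> /has_sumP fs; apply/cvgrPdistC_lt => e /fs [A hA].
have [n hn] := fset_nat_bound A; exists n => // m nm /=.
by rewrite -big_fset_iota; apply: hA; apply: hn.
Qed.

Lemma cvg_int_comp (K : numFieldType) (u : int -> K) (l : K)
    (g : nat -> int) (k : int) :
  u n%:Z @[n --> \oo] --> l ->
  (forall n : nat, n%:Z + k <= g n) ->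
  u (g n) @[n --> \oo] --> l.
Proof.
move=> /cvgrPdist_lt ul kg; apply/cvgrPdist_lt => e /ul [N _ hN].
exists (N + absz k)%N => // n /= Nn; have {}kg := kg n.
have -> : g n = absz (g n) by lia.
by apply: hN => /=; lia.
Qed.

Lemma cvg_normc_expr (x : R[i]) : normc x < 1 ->
  (x ^+ n : (R[i] : numFieldType)) @[n --> \oo] --> 0.
Proof.
move=> x1; apply: cvg_normc => e e0.
have /cvgrPdist_lt : (normc x ^+ n) @[n --> \oo] --> 0.
  by apply: cvg_expr; rewrite ger0_norm ?normc_ge0.
move=> /(_ e e0); apply: filterS => n.
by rewrite sub0r normrN subr0 normcX ger0_norm ?exprn_ge0 ?normc_ge0.
Qed.

Lemma exists_expr_lt (p e : R) : 0 <= p < 1 -> 0 < e ->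
  exists n, forall m, (n <= m)%N -> p ^+ m < e.
Proof.
move=> /andP[p0 p1] e0; have : `|p| < 1 by rewrite ger0_norm.
move=> /cvg_expr /cvgrPdist_lt /(_ e e0) [n _ hn]; exists n => m /hn.
by rewrite /= sub0r normrN ger0_norm ?exprn_ge0.
Qed.

End NatSums.

Section Products.
Variable R : realType.
Implicit Types (f : nat -> R[i]) (n : nat).

Lemma normc_prod_le_expR f n :
  normc (\prod_(j < n) (1 - f j)) <= expR (\sum_(j < n) normc (f j)).
Proof.
elim: n => [|n IH]; first by rewrite !big_ord0 normc1 expR0.
rewrite !big_ord_recr /= normcM expRD ler_pM ?normc_ge0 //.
by rewrite (le_trans (ler_normcD _ _)) // normc1 normc_opp expR_ge1Dx.
Qed.

Lemma normc_prod_ge_sub f n : \sum_(j < n) normc (f j) <= 1 ->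
  1 - \sum_(j < n) normc (f j) <= normc (\prod_(j < n) (1 - f j)).
Proof.
elim: n => [|n IH]; first by rewrite !big_ord0 normc1 subr0.
rewrite !big_ord_recr /= normcM => le1; have fn0 := normc_ge0 (f n).
have s0 : 0 <= \sum_(j < n) normc (f j) by apply: sumr_ge0 => j _; apply: normc_ge0.
have {}IH := IH ltac:(lra); have := normcB_ge 1 (f n); rewrite normc1 => fn1.
apply: le_trans (ler_pM _ _ IH fn1); [nra|lra|lra].
Qed.

End Products.

Section InfiniteQPochhammer.
Variables (R : realType) (Q : R[i]).
Hypothesis Q1 : normc Q < 1.
Local Notation C := (R[i] : numFieldType).
Implicit Types x y : R[i].

Let normQ : 0 <= normc Q < 1. Proof. by rewrite normc_ge0. Qed.

Lemma sum_normc_geometric_le x n :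
  \sum_(j < n) normc (x * Q ^+ j) <= normc x / (1 - normc Q).
Proof.
under eq_bigr do rewrite normcM normcX.
by rewrite -mulr_sumr ler_wpM2l ?normc_ge0 ?sum_geometric_le.
Qed.

Lemma qpoch_bounded x : exists B : R,
  forall y (n : nat), normc y <= normc x -> normc (qpoch y Q n) <= B.
Proof.
exists (expR (normc x / (1 - normc Q))) => y n yx; rewrite qpoch_natE.
rewrite (le_trans (normc_prod_le_expR (fun j => y * Q ^+ j) _)) // ler_expR.
rewrite (le_trans (sum_normc_geometric_le _ _)) // ler_wpM2r //.
by rewrite invr_ge0 subr_ge0 ltW.
Qed.

Lemma qpoch_inf_cvg x : (qpoch x Q n%:Z : C) @[n --> \oo] --> qpoch_inf x Q.
Proof.
have [B hB] := qpoch_bounded x.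
have hb : bounded_sums (fun n : nat => B * normc x * normc Q ^+ n).
  apply: bounded_sumsZ; last exact: bounded_sums_geometric.
  by rewrite mulr_ge0 ?normc_ge0 // (le_trans (normc_ge0 _) (hB x 0%N _)).
have [n|s /has_sum_series hs] := dominated_has_sum
    (f := fun n : nat => qpoch x Q n.+1 - qpoch x Q n) hb.
  rewrite !qpoch_natE big_ord_recr /= -qpoch_natE mulrBr mulr1 addrAC subrr add0r.
  rewrite normc_opp !normcM normcX mulrA !ler_wpM2r ?exprn_ge0 ?normc_ge0 //.
  exact: hB.
have xs : (qpoch x Q n%:Z : C) @[n --> \oo] --> s + 1.
  rewrite (_ : (fun n : nat => _) = (fun n => \sum_(i < n)
      (qpoch x Q i.+1 - qpoch x Q i : C)) \+ cst 1).
    by apply: cvgD hs _; exact: cvg_cst.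
  apply/funext => n /=; rewrite -(big_mkord xpredT (fun i : nat =>
    qpoch x Q i.+1 - qpoch x Q i)) telescope_sumr // qpoch0.
  by rewrite subrK.
by rewrite /qpoch_inf (cvg_lim (@norm_hausdorff _ C^o) xs).
Qed.

Lemma qpoch_inf_shift x m : Q != 0 -> qpoch_wd x Q m ->
  qpoch_inf x Q = qpoch x Q m * qpoch_inf (x * Q ^ m) Q.
Proof.
move=> Q0 wd.
apply: (num_cvg_unique (F := \oo) (u := fun n : nat => qpoch x Q (m + n%:Z) : C)).
  apply: (cvg_int_comp (g := fun n : nat => m + n%:Z) (k := m) (@qpoch_inf_cvg x)).
  by move=> n; rewrite addrC.
under eq_fun do rewrite qpochD //.
by apply: cvgM; [exact: cvg_cst|exact: qpoch_inf_cvg].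
Qed.

Lemma qpoch_inf_eq0_factor x (j : nat) : 1 - x * Q ^+ j = 0 -> qpoch_inf x Q = 0.
Proof.
move=> xj; apply: num_cvg_unique (@qpoch_inf_cvg x) _.
apply: cvg_normc => e e0; exists j.+1 => // n jn; rewrite /=.
by rewrite qpoch_natE (bigD1 (Ordinal jn)) //= xj mul0r subrr normc0.
Qed.

(* Far enough, the tail [(x Q^m; Q)_n] of the product is at least [1/2]. *)
Lemma qpoch_inf_neq0 x : Q != 0 -> (forall j, 1 - x * Q ^+ j != 0) ->
  qpoch_inf x Q != 0.
Proof.
move=> Q0 x_neq; have Q1' : 0 < 1 - normc Q by rewrite subr_gt0.
have x1 : 0 < 1 + normc x by rewrite ltr_pwDl ?normc_ge0.
have [m /(_ m (leqnn m)) hm] := exists_expr_lt normQ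
  (divr_gt0 Q1' (mulr_gt0 (ltr0n R 2) x1)).
rewrite (qpoch_inf_shift Q0 (@qpoch_wd_nat _ Q x m)) mulf_neq0 ?qpoch_neq0 //.
set y := x * Q ^ m; have y_small n : \sum_(j < n) normc (y * Q ^+ j) <= 2^-1.
  rewrite (le_trans (sum_normc_geometric_le _ _)) // ler_pdivrMr //.
  rewrite mulrC normcM normcX mulrC; move: hm; rewrite ltr_pdivlMr ?mulr_gt0 //.
  have := normc_ge0 x; have := exprn_ge0 m (normc_ge0 Q); nra.
apply/eqP => y0; have := normc_cvg (@qpoch_inf_cvg y) (ltac:(lra) : 0 < 2^-1 :> R).
case=> n _ /(_ n (leqnn n)); rewrite /= y0 subr0 qpoch_natE.
have := normc_prod_ge_sub (f := fun j => y * Q ^+ j) (n := n).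
by have := y_small n; lra.
Qed.

Lemma qpochV_inf_cvg x : Q != 0 -> (forall j, 1 - x * Q ^+ j != 0) ->
  ((qpoch x Q n%:Z)^-1 : C) @[n --> \oo] --> (qpoch_inf x Q)^-1.
Proof. by move=> Q0 x_neq; apply: cvgV (@qpoch_inf_cvg x); apply: qpoch_inf_neq0. Qed.

Lemma qpochV_bounded x : Q != 0 -> (forall j, 1 - x * Q ^+ j != 0) ->
  exists B : R, forall m n : nat, normc (qpoch (x * Q ^+ m) Q n)^-1 <= B.
Proof.
move=> Q0 x_neq; have [B hB] := qpoch_bounded x.
have /cvgP /cvg_seq_bounded [M [Mreal /(_ (M + 1))]] := qpochV_inf_cvg Q0 x_neq.
rewrite ltrDl ltr01 => /(_ isT) hM.
have M1 : M + 1 = (complex.Re (M + 1))%:C%C by rewrite RRe_real // realD.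
have {}hM (n : nat) : normc (qpoch x Q n)^-1 <= complex.Re (M + 1).
  by have := hM n I; rewrite /= {1}M1 normcE lecR.
exists (B * complex.Re (M + 1)) => m n.
have -> : (qpoch (x * Q ^+ m) Q n)^-1 = qpoch x Q m * (qpoch x Q (m + n)%N)^-1.
  by rewrite PoszD qpochD ?invfM ?mulVKf ?qpoch_neq0 //; exact: qpoch_wd_nat.
by rewrite normcM ler_pM ?normc_ge0 // hB.
Qed.

End InfiniteQPochhammer.

(** * Gaussian bounds *)

Section GaussianBounds.
Variables (R : realType) (q : R[i]).
Hypotheses (q0 : q != 0) (q1 : normc q < 1).
Local Notation C := (R[i] : numFieldType).
Local Notation rho := (normc q).

Let rho_gt0 : 0 < rho. Proof. by rewrite normc_gt0. Qed.
Let rho_ge0 : 0 <= rho. Proof. exact: normc_ge0. Qed.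
Let rhoV_ge1 : 1 <= rho^-1. Proof. by rewrite invf_ge1 ?ltW. Qed.

Lemma normc_exprz_le (m n : int) : n <= m -> rho ^ m <= rho ^ n.
Proof.
move=> nm; have -> : m = n + (absz (m - n))%:Z by lia.
by rewrite expfzDr ?gt_eqF // ler_piMr ?exprz_ge0 ?exprn_ile1 ?ltW.
Qed.

(* [l] collects the linear and [e] the quadratic exponents; [B] and [M] are
   uniform in the index, so that a bound over a product of index types is a
   domination that is uniform in one of them. *)
Definition gaussian_bound (I : Type) (l : I -> nat) (e : I -> int) (f : I -> R[i]) :=
  exists B M : R, [/\ 0 <= B, 1 <= M &
    forall i, normc (f i) <= B * M ^+ l i * rho ^ e i].

Section OneType.
Variable I : Type.
Implicit Types (l : I -> nat) (e : I -> int) (f g : I -> R[i]).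

Lemma eq_gaussian_bound l e f g :
  f =1 g -> gaussian_bound l e f -> gaussian_bound l e g.
Proof. by move=> /funext ->. Qed.

(* Since [rho ^ - K] can be absorbed in [M], linear losses in [e] are harmless. *)
Lemma gaussian_boundW (K : nat) l e l' e' f : gaussian_bound l e f ->
  (forall i, f i != 0 -> (l i <= K * l' i + K)%N /\
     e' i <= e i + K%:Z * (l' i)%:Z + K%:Z) ->
  gaussian_bound l' e' f.
Proof.
move=> [B [M [B0 M1 fB]]] le_le'; have M0 : 0 <= M by apply: le_trans M1.
exists (B * M ^+ K * rho^-1 ^+ K), (M ^+ K * rho^-1 ^+ K); split.
- by rewrite !mulr_ge0 ?exprn_ge0 ?invr_ge0.
- by rewrite mulr_ege1 // exprn_ege1.
move=> i; have [->|/le_le'[hl he]] := eqVneq (f i) 0.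
  by rewrite normc0 !mulr_ge0 ?exprn_ge0 ?exprz_ge0 ?mulr_ge0 ?exprn_ge0 ?invr_ge0.
apply: le_trans (fB i) _.
have -> : B * M ^+ K * rho^-1 ^+ K * (M ^+ K * rho^-1 ^+ K) ^+ l' i * rho ^ e' i
   = B * M ^+ (K * l' i + K) * rho ^ (e' i - (K%:Z * (l' i)%:Z + K%:Z)).
  rewrite exprMn -!exprM exprD expfzDr ?gt_eqF // -PoszM -PoszD -exprnN.
  by rewrite -exprVn exprD; ring.
rewrite ler_pM ?mulr_ge0 ?exprn_ge0 ?exprz_ge0 //; last first.
  by apply: normc_exprz_le; lia.
by rewrite ler_wpM2l // ler_weXn2l.
Qed.

Lemma gaussian_boundM l1 l2 e1 e2 f g :
  gaussian_bound l1 e1 f -> gaussian_bound l2 e2 g ->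
  gaussian_bound (fun i => l1 i + l2 i)%N (fun i => e1 i + e2 i)
    (fun i => f i * g i).
Proof.
move=> [B [M [B0 M1 fB]]] [D [N [D0 N1 gD]]].
have M0 : 0 <= M by apply: le_trans M1.
have N0 : 0 <= N by apply: le_trans N1.
exists (B * D), (M * N); split; rewrite ?mulr_ge0 ?mulr_ege1 // => i.
rewrite normcM (le_trans (ler_pM _ _ (fB i) (gD i))) ?normc_ge0 //.
have -> : B * M ^+ l1 i * rho ^ e1 i * (D * N ^+ l2 i * rho ^ e2 i)
  = B * D * (M ^+ l1 i * N ^+ l2 i) * rho ^ (e1 i + e2 i).
  by rewrite expfzDr ?gt_eqF //; ring.
rewrite ler_wpM2r ?exprz_ge0 // ler_wpM2l ?mulr_ge0 // exprMn !exprD.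
rewrite ler_pM ?exprn_ge0 //; first by rewrite ler_peMr ?exprn_ge0 ?exprn_ege1.
by rewrite ler_peMl ?exprn_ge0 ?exprn_ege1.
Qed.

Lemma gaussian_boundD l e f g : gaussian_bound l e f -> gaussian_bound l e g ->
  gaussian_bound l e (fun i => f i + g i).
Proof.
move=> [B [M [B0 M1 fB]]] [D [N [D0 N1 gD]]].
have M0 : 0 <= M by apply: le_trans M1.
have N0 : 0 <= N by apply: le_trans N1.
exists (B + D), (M * N); split; rewrite ?addr_ge0 ?mulr_ege1 // => i.
rewrite (le_trans (ler_normcD _ _)) // !mulrDl exprMn lerD //.
  rewrite (le_trans (fB i)) // ler_wpM2r ?exprz_ge0 // ler_wpM2l //.
  by rewrite ler_peMr ?exprn_ge0 ?exprn_ege1.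
rewrite (le_trans (gD i)) // ler_wpM2r ?exprz_ge0 // ler_wpM2l //.
by rewrite ler_peMl ?exprn_ge0 ?exprn_ege1.
Qed.

Lemma bounded_gaussian_bound f (B : R) : (forall i, normc (f i) <= B) ->
  gaussian_bound (fun=> 0%N) (fun=> 0) f.
Proof.
move=> fB; exists `|B|, 1; split=> // i.
by rewrite expr0 expr0z !mulr1 (le_trans (fB i)) // ler_norm.
Qed.

Lemma gaussian_boundZ c l e f :
  gaussian_bound l e f -> gaussian_bound l e (fun i => c * f i).
Proof.
have hc : gaussian_bound (fun=> 0%N) (fun=> 0) (fun _ : I => c).
  exact: (@bounded_gaussian_bound _ (normc c)).
by move=> hf; apply: (gaussian_boundW (K := 1) (gaussian_boundM hc hf)) => i _ /=; lia.
Qed.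

Lemma gaussian_boundB l e f g : gaussian_bound l e f -> gaussian_bound l e g ->
  gaussian_bound l e (fun i => f i - g i).
Proof.
move=> hf /(gaussian_boundZ (-1)) /(gaussian_boundD hf).
by apply: eq_gaussian_bound => i; rewrite mulN1r.
Qed.

Lemma gaussian_bound_exprz x (n : I -> int) : x != 0 ->
  gaussian_bound (fun i => absz (n i)) (fun=> 0) (fun i => x ^ n i).
Proof.
rewrite -normc_gt0 => x0; have xV : 0 < (normc x)^-1 by rewrite invr_gt0.
exists 1, (1 + normc x + (normc x)^-1); split=> //; first by lra.
move=> i; rewrite expr0z mul1r mulr1 normcXz.
case: (n i) => m /=; first by rewrite -exprnP lerXn2r ?nnegrE; lra.
by rewrite NegzE -exprnN -exprVn lerXn2r ?nnegrE; lra.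
Qed.

Lemma gaussian_bound_qexprz (e : I -> int) :
  gaussian_bound (fun=> 0%N) e (fun i => q ^ e i).
Proof. by exists 1, 1; split=> // i; rewrite expr1n !mul1r normcXz. Qed.

(* As soon as [(2 M)^K rho^l <= 1], the [K]-th power of [(2 M)^l rho^e] is at
   most [((2 M)^K rho^l)^l <= 1]. *)
Lemma geometric_le_gaussian (K : nat) (M : R) : (0 < K)%N -> 1 <= M ->
  exists2 B, 0 <= B & forall l n : nat, (l ^ 2 <= K * n)%N ->
    M ^+ l * rho ^+ n <= B * 2^-1 ^+ l.
Proof.
move=> K0 M1; have M2 : 1 <= 2 * M by lra.
have M20 : 0 <= 2 * M by lra.
have MK : 0 < ((2 * M) ^+ K)^-1 by rewrite invr_gt0 exprn_gt0 //; lra.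
have [|n0 hn0] := exists_expr_lt _ MK (p := rho); first by rewrite rho_ge0.
exists ((2 * M) ^+ n0) => [|l n ln]; first by rewrite exprn_ge0.
have rho_n := exprn_ge0 n rho_ge0.
rewrite exprVn ler_pdivlMr ?exprn_gt0 // mulrAC -exprMn [M * 2]mulrC.
have [ln0|n0l] := ltnP l n0.
  apply: (@le_trans _ _ ((2 * M) ^+ l)); last by rewrite ler_weXn2l // ltnW.
  by rewrite ler_piMr ?exprn_ge0 // exprn_ile1 // ltW.
apply: le_trans (_ : _ <= 1) (exprn_ege1 _ M2).
rewrite -(expr_le1 K0) ?mulr_ge0 ?exprn_ge0 // exprMn -!exprM.
apply: (@le_trans _ _ ((2 * M) ^+ (l * K) * rho ^+ (l ^ 2))).
  by rewrite ler_wpM2l ?exprn_ge0 // ler_wiXn2l // 1?ltW // mulnC.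
rewrite -mulnn mulnC !exprM -exprMn exprn_ile1 //.
  by rewrite mulr_ge0 ?exprn_ge0.
by have := hn0 l n0l; rewrite -[X in _ < X]mul1r ltr_pdivlMr ?exprn_gt0 1?mulrC; lra.
Qed.

Lemma gaussian_bound_geometric (K : nat) l e f : (0 < K)%N ->
  gaussian_bound l e f ->
  (forall i, f i != 0 -> ((l i) ^ 2)%:Z <= K%:Z * e i) ->
  exists2 B, 0 <= B & forall i, normc (f i) <= B * 2^-1 ^+ l i.
Proof.
move=> K0 [B [M [B0 M1 fB]]] le_Ke.
have [D D0 hD] := geometric_le_gaussian K0 M1.
exists (B * D) => [|i]; first exact: mulr_ge0.
have [->|/le_Ke {}le_Ke] := eqVneq (f i) 0.
  by rewrite normc0 !mulr_ge0 ?exprn_ge0 //; lra.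
have eE : e i = absz (e i) by nia.
apply: le_trans (fB i) _; rewrite -!mulrA ler_wpM2l // eE hD //.
by move: le_Ke; rewrite eE; lia.
Qed.

End OneType.

Lemma gaussian_bound_comp (I J : Type) (h : J -> I) l e f : gaussian_bound l e f ->
  gaussian_bound (l \o h) (e \o h) (f \o h).
Proof. by move=> [B [M [B0 M1 fB]]]; exists B, M; split=> // j; apply: fB. Qed.

Lemma bounded_sums_half : bounded_sums (fun n : int => 2^-1 ^+ absz n : R).
Proof. by apply: bounded_sums_geometric_int; lra. Qed.

Lemma gaussian_bound_dominated (T : Type) (K : nat) (f : T -> int -> C) e :
  (0 < K)%N -> gaussian_bound (fun p => absz p.2) e (fun p => f p.1 p.2) ->
  (forall t n, f t n != 0 -> n ^+ 2 <= K%:Z * e (t, n)) ->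
  exists2 b, bounded_sums b & forall t n, normc (f t n) <= b n.
Proof.
move=> K0 hf le_Ke.
have [[t n] /= /le_Ke|B B0 hB] := gaussian_bound_geometric K0 hf; first by lia.
exists (fun n => B * 2^-1 ^+ absz n).
  exact: bounded_sumsZ bounded_sums_half.
by move=> t n; apply: (hB (t, n)).
Qed.

Lemma gaussian_bound_exprzM x e (f : int -> R[i]) : x != 0 ->
  gaussian_bound absz e f -> gaussian_bound absz e (fun n => x ^ n * f n).
Proof.
move=> x0 hf.
apply: (gaussian_boundW (K := 2) (gaussian_boundM (gaussian_bound_exprz id x0) hf)).
by move=> n _ /=; lia.
Qed.

Lemma gaussian_bound_has_sum (K : nat) (f : int -> C) e : (0 < K)%N ->
  gaussian_bound absz e f -> (forall n, f n != 0 -> n ^+ 2 <= K%:Z * e n) ->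
  exists s, has_sum f s.
Proof.
move=> K0 hf le_Ke.
have [[] n|b hb fb] := @gaussian_bound_dominated unit K (fun _ => f) (e \o snd) K0
  (gaussian_bound_comp snd hf).
  exact: le_Ke.
exact: dominated_has_sum hb (fb tt).
Qed.

(* Of the terms weighted by [(q^(2 M))^m] only the one of index [m = 0] survives. *)
Lemma has_sum_qscale_cvg (K : nat) (f : nat -> int -> C) e (S : nat -> C) (L : C) :
  (0 < K)%N -> gaussian_bound (fun p => absz p.2) e (fun p => f p.1 p.2) ->
  (forall M m, f M m != 0 -> 0 <= m /\ m ^+ 2 <= K%:Z * e (M, m)) ->
  (forall M, has_sum (fun m => (q ^+ 2 ^+ M) ^ m * f M m) (S M)) ->
  f M 0 @[M --> \oo] --> L -> S @ \oo --> L.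
Proof.
move=> K0 hf le_Ke hS f0.
have [M m /le_Ke[]//|b hb fb] := gaussian_bound_dominated K0 hf.
have Q1 : normc (q ^+ 2) < 1 by rewrite normcX exprn_ilt1.
pose g (m : int) : C := if m == 0 then L else 0.
have hg : has_sum g L.
  have <- : g 0 = L by rewrite /g eqxx.
  by apply: has_sum_single => m /negbTE m0; rewrite /g m0.
have qM_le M m : normc ((q ^+ 2 ^+ M) ^ m * f M m) <= b m.
  apply: le_trans (fb M m); have [->|/le_Ke[m0 _]] := eqVneq (f M m) 0.
    by rewrite mulr0.
  rewrite normcM ler_piMl ?normc_ge0 // normcXz normcX -(gez0_abs m0) -exprnP.
  by rewrite !exprn_ile1 ?exprn_ge0 ?normc_ge0 // ltW.
apply: (has_sum_dominated_cvg hb qM_le _ hS hg) => m; rewrite /g.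
have [->|m_neq0] := eqVneq m 0; first by under eq_fun do rewrite expr0z mul1r.
have [m_lt0|m_ge0] := ltP m 0.
  rewrite (_ : (fun M : nat => _) = cst 0); first exact: cvg_cst.
  apply/funext => M; have [->|/le_Ke[]] := eqVneq (f M m) 0; first by rewrite mulr0.
  by rewrite leNgt m_lt0.
have {m_neq0 m_ge0} [k ->] : exists k, m = k.+1%:Z by exists (absz m).-1; lia.
apply: cvg_normc => d d0.
have Qk1 : normc (q ^+ 2 ^+ k.+1) < 1 by rewrite normcX exprn_ilt1 ?normc_ge0.
have b1 : 0 < b k.+1 + 1 by rewrite ltr_wpDl // (le_trans (normc_ge0 _) (fb 0%N _)).
apply: filterS (normc_cvg (cvg_normc_expr Qk1) (divr_gt0 d0 b1)) => M.
rewrite !subr0 normcM -exprnP exprAC ltr_pdivlMr // => ltd.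
apply: le_lt_trans ltd; rewrite ler_wpM2l ?normc_ge0 //.
by rewrite (le_trans (fb M _)) // lerDl.
Qed.

End GaussianBounds.

Section QPochhammerBounds.
Variables (R : realType) (q : R[i]).
Hypotheses (q0 : q != 0) (q1 : normc q < 1).
Local Notation Q := (q ^+ 2).

Lemma normc_qbase_lt1 : normc Q < 1.
Proof. by rewrite normcX exprn_ilt1 ?normc_ge0. Qed.

Lemma qbase_not_root (j : nat) : 1 - Q * Q ^+ j != 0.
Proof.
rewrite -exprS subr_eq0; apply/eqP => e.
have : normc (Q ^+ j.+1) < 1 by rewrite normcX exprn_ilt1 ?normc_ge0 ?normc_qbase_lt1.
by rewrite -e normc1 ltxx.
Qed.

Lemma gaussian_bound_int e (f : int -> R[i]) :
  gaussian_bound q id (fun n : nat => e n%:Z) (fun n : nat => f n%:Z) ->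
  gaussian_bound q id (fun n : nat => e (- n%:Z)) (fun n : nat => f (- n%:Z)) ->
  gaussian_bound q absz e f.
Proof.
move=> [B [M [B0 M1 fB]]] [D [N [D0 N1 fD]]].
have M0 : 0 <= M by apply: le_trans M1.
have N0 : 0 <= N by apply: le_trans N1.
exists (B + D), (M * N); split; rewrite ?addr_ge0 ?mulr_ege1 // => n.
have [m [->|->]] : exists m : nat, n = m \/ n = - m%:Z by exists (absz n); lia.
  rewrite (le_trans (fB m)) // ler_wpM2r ?exprz_ge0 ?normc_ge0 // exprMn.
  by rewrite ler_pM ?exprn_ge0 ?lerDl // ler_peMr ?exprn_ge0 ?exprn_ege1.
rewrite abszN (le_trans (fD m)) // ler_wpM2r ?exprz_ge0 ?normc_ge0 // exprMn.
by rewrite ler_pM ?exprn_ge0 ?lerDr // ler_peMl ?exprn_ge0 ?exprn_ege1.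
Qed.

Definition neg_sqr (n : int) : int := if n < 0 then n ^+ 2 else 0.

Lemma neg_sqr_itv n : 0 <= neg_sqr n <= n ^+ 2.
Proof. by rewrite /neg_sqr; case: ifP => _; rewrite ?lexx sqr_ge0. Qed.

Lemma gaussian_bound_qpochV (x : R[i]) : x != 0 -> qregular Q x ->
  gaussian_bound q absz (fun n => - neg_sqr n) (fun n => (qpoch x Q n)^-1).
Proof.
move=> x0 xQ; have [B hB] := qpoch_bounded normc_qbase_lt1 (Q / x).
have [D hD] := qpochV_bounded normc_qbase_lt1 (qbase_neq0 q0)
  (fun j => qregular_nat j xQ).
apply: gaussian_bound_int.
  apply: (gaussian_boundW q0 q1 (K := 1) (bounded_gaussian_bound q (B := D) _)) => n.
    by have := hD 0%N n; rewrite expr0 mulr1.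
  by rewrite /neg_sqr /=; split; lia.
have nx0 : - x != 0 by rewrite oppr_eq0.
apply: (eq_gaussian_bound (f := fun n : nat => (- x) ^ n%:Z * q ^ (- (n%:Z ^+ 2 + n%:Z))
    * qpoch (Q / x) Q n)) => [n|].
  have x_neq0 := qregular_neq0 (- n%:Z) xQ; apply: (mulfI x_neq0).
  rewrite mulfV // mulrCA qpoch_opp_reflect //; last exact: qregular_wd.
  have := expfz_neq0 n%:Z nx0; have := expfz_neq0 (n%:Z ^+ 2 + n%:Z) q0.
  rewrite -!invr_expz; move: ((- x) ^ _) (q ^ _) => a b b0 a0.
  by rewrite mulrACA mulfV // mulVf // mulr1.
apply: (gaussian_boundW q0 q1 (K := 1) (gaussian_boundM q0
  (gaussian_boundM q0 (gaussian_bound_exprz q (fun n : nat => n%:Z) nx0)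
     (gaussian_bound_qexprz q _))
  (bounded_gaussian_bound q (B := B) _))) => n; first exact: hB.
by move=> _ /=; rewrite /neg_sqr; split; [lia|case: ifP; lia].
Qed.

Lemma gaussian_bound_qpoch (x : R[i]) : x != 0 -> (forall n, qpoch_wd x Q n) ->
  gaussian_bound q absz neg_sqr (qpoch x Q).
Proof.
move=> x0 wd; have [B hB] := qpoch_bounded normc_qbase_lt1 x.
have Qx_neq (j : nat) : 1 - Q / x * Q ^+ j != 0.
  rewrite (exprnP Q j) qpoch_factor_reflect // mulf_neq0 ?oppr_eq0 //.
    by rewrite mulf_neq0 ?expfz_neq0 ?invr_eq0.
  have := wd (- j.+1%:Z) j.+1 isT; rewrite opprK lexx exprnN.
  by rewrite (_ : j.+1%:Z = j%:Z + 1); [apply|lia].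
have [D hD] := qpochV_bounded normc_qbase_lt1 (qbase_neq0 q0) Qx_neq.
apply: gaussian_bound_int.
  apply: (gaussian_boundW q0 q1 (K := 1) (bounded_gaussian_bound q (B := B) _)) => n.
    exact: hB.
  by rewrite /neg_sqr /=; split; lia.
have nx0 : - x != 0 by rewrite oppr_eq0.
apply: (eq_gaussian_bound (f := fun n : nat => (- x) ^ (- n%:Z) * q ^ (n%:Z ^+ 2 + n%:Z)
    * (qpoch (Q / x) Q n)^-1)) => [n|].
  by rewrite -(qpoch_opp_reflect q0 x0 (wd _)) mulfK // qpoch_neq0.
apply: (gaussian_boundW q0 q1 (K := 1) (gaussian_boundM q0
  (gaussian_boundM q0 (gaussian_bound_exprz q (fun n : nat => - n%:Z) nx0)
     (gaussian_bound_qexprz q _))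
  (bounded_gaussian_bound q (B := D) _))) => n.
  by have := hD 0%N n; rewrite expr0 mulr1.
by move=> _ /=; rewrite /neg_sqr; split; [lia|case: ifP; lia].
Qed.

Lemma inv_qfact_bounded : exists B : R, forall n, normc (inv_qfact q n) <= B.
Proof.
have [B hB] := qpochV_bounded normc_qbase_lt1 (qbase_neq0 q0) qbase_not_root.
exists `|B| => -[n|n]; last by rewrite inv_qfact_neg // normc0.
by rewrite (le_trans _ (ler_norm B)) //; have := hB 0%N n; rewrite expr0 mulr1.
Qed.

Lemma gaussian_bound_inv_qfact :
  gaussian_bound q (fun=> 0%N) (fun=> 0) (inv_qfact q).
Proof. by have [B hB] := inv_qfact_bounded; apply: bounded_gaussian_bound hB. Qed.

Lemma gaussian_bound_inv_qfactM (T : Type) (g : T -> int -> R[i]) (B : R) :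
  (forall t (n : nat), normc (g t n) <= B) ->
  gaussian_bound q (fun=> 0%N) (fun=> 0)
    (fun p : T * int => inv_qfact q p.2 * g p.1 p.2).
Proof.
have [D hD] := inv_qfact_bounded => gB.
apply: (@bounded_gaussian_bound _ _ _ _ `|D * B|) => -[t [n|n]] /=; last first.
  by rewrite inv_qfact_neg // mul0r normc0.
by rewrite normcM (le_trans _ (ler_norm _)) // ler_pM ?normc_ge0.
Qed.

End QPochhammerBounds.

(** * Unilateral summation formulas *)

Section QSeriesTerms.
Variables (F : fieldType) (q : F).
Hypothesis q0 : q != 0.
Local Notation Q := (q ^+ 2).
Hypothesis q_not_root : forall j, 1 - Q * Q ^+ j != 0.
Local Notation iQ := (inv_qfact q).
Implicit Types (a b x : F) (n : int).

Lemma inv_qfact_qpoch_front x n : 1 - x != 0 ->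
  iQ (n - 1) / qpoch (x * Q) Q (n - 1) = iQ n * (1 - Q ^ n) * (1 - x) / qpoch x Q n.
Proof.
move=> x1; rewrite inv_qfact_pred //; have [n0|n0|->] := ltgtP n 0; first 2 last.
- by rewrite expr0z subrr !(mulr0, mul0r).
- by rewrite inv_qfact_neg // !mul0r.
have -> : n = (absz n).-1%:Z + 1 by lia.
by rewrite addrK qpoch_front ?qbase_neq0 // -!mulrA invfM mulVKf.
Qed.

(* The terms of 1phi1(a; ab; Q, b). *)
Definition phi11_term a b n : F :=
  iQ n * (qpoch a Q n / qpoch (a * b) Q n) * ((- b) ^ n * q ^ (n ^+ 2 - n)).

Lemma phi11_term_scale a b x n : phi11_term a (b * x) n = x ^ n *
  (iQ n * (qpoch a Q n / qpoch (a * b * x) Q n) * ((- b) ^ n * q ^ (n ^+ 2 - n))).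
Proof. by rewrite /phi11_term -(mulNr b) (expfzMl (- b)) (mulrA a b); ring. Qed.

(* Splitting [1 = Q^n + (1 - Q^n)] and shifting the second part of the sum. *)
Lemma phi11_termS a b n : b != 0 -> (forall j, 1 - a * b * Q ^+ j != 0) ->
  Q ^ n * phi11_term a b n + (1 - Q ^ (n + 1)) * phi11_term a b (n + 1)
  = (1 - b) / (1 - a * b) * phi11_term a (b * Q) n.
Proof.
move=> b0 ab_neq.
rewrite [X in _ + X](_ : _ = iQ n * (qpoch a Q (n + 1) / qpoch (a * b) Q (n + 1))
   * ((- b) ^ (n + 1) * q ^ ((n + 1) ^+ 2 - (n + 1)))); last first.
  by rewrite [in RHS]inv_qfactS // /phi11_term; ring.
rewrite /phi11_term; case: n => n; last first.
  by rewrite inv_qfact_neg // !(mul0r, mulr0) addr0.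
have d0 : qpoch (a * b) Q n != 0 by apply: qpoch_neq0.
have ab1 : 1 - a * b != 0 by have := ab_neq 0%N; rewrite expr0 mulr1.
have dQ : qpoch (a * (b * Q)) Q n
    = qpoch (a * b) Q n * (1 - a * b * Q ^ n%:Z) / (1 - a * b).
  rewrite mulrA -qpochS; last exact: qpoch_wd_nat.
  by rewrite qpoch_front ?qbase_neq0 // [RHS]mulrC mulKf.
rewrite dQ !qpochS; try exact: qpoch_wd_nat.
rewrite (_ : (n%:Z + 1) ^+ 2 - (n%:Z + 1) = (n%:Z ^+ 2 - n%:Z) + 2 * n%:Z); last by ring.
rewrite (expfzDr n%:Z 1) ?oppr_eq0 // expr1z -(mulNr b Q) (expfzMl (- b) Q).
rewrite (expfzDr (n%:Z ^+ 2 - n%:Z) (2 * n%:Z) q0) -qbase_exprz.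
have := ab_neq n; rewrite (exprnP Q n).
move: (Q ^ n%:Z) (q ^ _) (iQ _) => X y i abX.
by field; rewrite d0 abX ab1.
Qed.

(* The very-well-poised 6phi5 series with first parameter [b^2], one parameter
   equal to [b], and two parameters sent to infinity. *)
Definition phi65_term b n : F :=
  iQ n * qpoch (b ^+ 2) Q n * (b ^ n * q ^ (2 * n ^+ 2)) * (1 + b * Q ^ n).

Lemma phi65_term_scale b x n : phi65_term (b * x) n = x ^ n *
  (iQ n * (qpoch ((b * x) ^+ 2) Q n * (1 + b * x * Q ^ n))
   * (b ^ n * q ^ (2 * n ^+ 2))).
Proof. by rewrite /phi65_term (expfzMl b); ring. Qed.

Definition phi65_cert b n : F :=
  (1 - Q ^ n) * (1 - b - b ^+ 2 * Q ^ n)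
  * (iQ n * qpoch (b ^+ 2) Q n * (b ^ n * q ^ (2 * n ^+ 2))).

Lemma phi65_termS b n : b != 0 ->
  (1 - b) * phi65_term b n - phi65_cert b n + phi65_cert b (n + 1)
  = (1 - b ^+ 2) * (1 - b ^+ 2 * Q) * phi65_term (b * Q) n.
Proof.
move=> b0; rewrite [X in _ + X](_ : _ = (1 - b - b ^+ 2 * Q ^ (n + 1))
   * (iQ n * qpoch (b ^+ 2) Q (n + 1) * (b ^ (n + 1) * q ^ (2 * (n + 1) ^+ 2))));
   last by rewrite [in RHS]inv_qfactS // /phi65_cert; ring.
rewrite /phi65_term /phi65_cert.
case: n => n; last by rewrite inv_qfact_neg // !(mul0r, mulr0) subr0 addr0.
have front2 : (1 - b ^+ 2) * (1 - b ^+ 2 * Q) * qpoch ((b * Q) ^+ 2) Q n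
    = qpoch (b ^+ 2) Q n * (1 - b ^+ 2 * Q ^ n%:Z) * (1 - b ^+ 2 * Q * Q ^ n%:Z).
  rewrite -qpochS ?qpoch_front ?qbase_neq0 //; last exact: qpoch_wd_nat.
  rewrite -[RHS]mulrA -qpochS ?qpoch_front ?qbase_neq0 //; last exact: qpoch_wd_nat.
  by rewrite -mulrA (_ : (b * Q) ^+ 2 = b ^+ 2 * Q * Q) //; ring.
have -> : forall c d e : F, (1 - b ^+ 2) * (1 - b ^+ 2 * Q)
    * (c * qpoch ((b * Q) ^+ 2) Q n * d * e)
  = c * ((1 - b ^+ 2) * (1 - b ^+ 2 * Q) * qpoch ((b * Q) ^+ 2) Q n) * d * e.
  by move=> *; ring.
rewrite front2.
rewrite qpochS; last exact: qpoch_wd_nat.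
have -> : q ^ (2 * (n%:Z + 1) ^+ 2) = q ^ (2 * n%:Z ^+ 2) * (Q ^ n%:Z * Q ^ n%:Z * Q).
  by rewrite qbase_exprz (exprnP q 2) -!expfzDr //; congr (_ ^ _); ring.
rewrite (expfzDr n%:Z 1 b0) expr1z.
rewrite (expfzDr _ _ (qbase_neq0 q0)) expr1z (expfzMl b Q).
by move: (Q ^ n%:Z) (q ^ _) (b ^ _) (iQ _) (qpoch _ _ _) => *; ring.
Qed.

End QSeriesTerms.

Section FiniteSums.
Variables (K : numFieldType) (q : K).
Hypothesis q0 : q != 0.
Local Notation Q := (q ^+ 2).
Hypothesis q_not_root : forall j, 1 - Q * Q ^+ j != 0.
Local Notation iQ := (inv_qfact q).
Implicit Types (a x : K) (n : int).

(* The sums of [qcv_term] and [triple_term] are computed by induction, splitting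
   [1 - Q^(m+n) = (1 - Q^m) + Q^m (1 - Q^n)] and shifting the second part. *)
Definition qcv_term (N : int) a n : K :=
  a ^ n * q ^ (2 * n ^+ 2) * iQ (N - n) * (iQ n / qpoch (a * Q) Q n).

Lemma qcv_termS N a n : a != 0 -> 1 - a * Q != 0 ->
  (1 - Q ^ (N + 1)) * qcv_term (N + 1) a n
  = qcv_term N a n + a * Q ^ (N + 1) / (1 - a * Q) * qcv_term N (a * Q) (n - 1).
Proof.
move=> a0 aQ1; rewrite /qcv_term (inv_qfact_qpoch_front _ _ _ aQ1) //.
have -> : N - (n - 1) = N + 1 - n by ring.
have -> : iQ (N - n) = iQ (N + 1 - n) * (1 - Q ^ (N + 1 - n)).
  by rewrite -inv_qfact_pred //; congr iQ; ring.
have -> : (a * Q) ^ (n - 1) * q ^ (2 * (n - 1) ^+ 2)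
    = a ^ n / a * q ^ (2 * n ^+ 2) / Q ^ n.
  rewrite (expfzMl a Q) (expfzDr n (-1) a0) -(invr_expz a) expr1z !qbase_exprz.
  rewrite (invr_expz q) -!mulrA -!expfzDr //; congr (_ * (_ * _ ^ _)); ring.
rewrite (expfzDr (N + 1) (- n)) ?qbase_neq0 // -invr_expz.
have := expfz_neq0 n (qbase_neq0 q0).
move: (Q ^ (N + 1)) (Q ^ n) (a ^ n) (q ^ _) (iQ _) (iQ n) (qpoch _ _ _)^-1.
by move=> Y X A B i j d X0; field; rewrite X0 a0 aQ1.
Qed.

Lemma q_chu_vandermonde_nat (N : nat) a : a != 0 ->
  (forall j, 1 - a * Q * Q ^+ j != 0) ->
  has_sum (qcv_term N a) (iQ N / qpoch (a * Q) Q N).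
Proof.
elim: N a => [|N IH] a a0 aQ_neq.
  have -> : iQ 0 / qpoch (a * Q) Q 0 = qcv_term 0 a 0.
    by rewrite /qcv_term subr0 qpoch0 inv_qfact0 expr0n mulr0 !expr0z !mul1r.
  apply: has_sum_single => n n0; rewrite /qcv_term sub0r.
  have [n_lt0|n_ge0] := ltP n 0.
    by rewrite (inv_qfact_neg q0 n_lt0) !(mul0r, mulr0).
  by rewrite [iQ (- n)]inv_qfact_neg ?(mulr0, mul0r) //; lia.
have aQ1 : 1 - a * Q != 0 by have := aQ_neq 0%N; rewrite expr0 mulr1.
have QN : 1 - Q ^ (N%:Z + 1) != 0.
  by rewrite expfzDr ?qbase_neq0 // expr1z mulrC; apply: q_not_root.
have IHa := IH a a0 aQ_neq.
have {IH} IHaQ : has_sum (qcv_term N (a * Q)) (iQ N / qpoch (a * Q * Q) Q N).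
  by apply: IH => [|j]; rewrite ?mulf_neq0 ?qbase_neq0 // -mulrA -exprS.
have := has_sumD IHa
  (has_sumZ (a * Q ^ (N%:Z + 1) / (1 - a * Q)) (has_sum_shift (-1) IHaQ)).
move=> /(has_sumZ (1 - Q ^ (N%:Z + 1))^-1).
rewrite (_ : _ * (_ + _) = iQ N.+1 / qpoch (a * Q) Q N.+1).
  apply: eq_has_sum => n; rewrite (_ : N.+1%:Z = N%:Z + 1); last by lia.
  by rewrite -qcv_termS // mulKf.
rewrite (_ : N.+1%:Z = N%:Z + 1); last by lia.
have frontQ : qpoch (a * Q * Q) Q N = qpoch (a * Q) Q (N%:Z + 1) / (1 - a * Q).
  by rewrite qpoch_front ?qbase_neq0 // [RHS]mulrC mulKf.
rewrite frontQ inv_qfactS // qpochS; last exact: qpoch_wd_nat.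
rewrite (expfzDr _ 1 (qbase_neq0 q0)) expr1z in QN *.
have := aQ_neq N; rewrite (exprnP Q N); have := qpoch_neq0 N aQ_neq.
move: QN; move: (Q ^ N%:Z) (iQ _) (qpoch _ _ _) => Y i d QN d0 aY.
by field; rewrite QN d0 aQ1 aY.
Qed.

Lemma q_chu_vandermonde (N : int) a : a != 0 ->
  (forall j, 1 - a * Q * Q ^+ j != 0) ->
  has_sum (qcv_term N a) (iQ N / qpoch (a * Q) Q N).
Proof.
move=> a0 aQ_neq; case: N => N; first exact: q_chu_vandermonde_nat.
have term0 n : qcv_term (Negz N) a n = 0.
  rewrite /qcv_term; have [n_lt0|n_ge0] := ltP n 0.
    by rewrite (inv_qfact_neg q0 n_lt0) mul0r mulr0.
  by rewrite [iQ (Negz N - n)]inv_qfact_neg ?(mulr0, mul0r) //; lia.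
rewrite inv_qfact_neg // mul0r -(term0 0).
by apply: has_sum_single => n _; apply: term0.
Qed.

Definition triple_term x (M N : int) n : K :=
  (- x) ^ n * q ^ (n ^+ 2 - n) * iQ (M + n) * iQ (N - n).

Lemma triple_term_opp x M N n :
  triple_term x M N (- n) = triple_term (Q / x) N M n.
Proof.
rewrite /triple_term opprK mulrAC; congr (_ * _ * _).
have -> : - (Q / x) = Q / (- x) by rewrite invrN mulrN.
rewrite (expfzMl Q (- x)^-1) exprz_inv [RHS]mulrAC qbase_exprz -expfzDr // [RHS]mulrC.
by congr (_ * _ ^ _); ring.
Qed.

Lemma triple_termS x M N n : x != 0 ->
  (1 - Q ^ (M + N + 1)) * triple_term x M (N + 1) n
  = triple_term x M N n - x * Q ^ N * triple_term x M N (n - 1).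
Proof.
move=> x0; have nx0 : - x != 0 by rewrite oppr_eq0.
rewrite /triple_term.
have -> : iQ (M + (n - 1)) = iQ (M + n) * (1 - Q ^ (M + n)).
  by rewrite -inv_qfact_pred // addrA.
have -> : iQ (N - n) = iQ (N + 1 - n) * (1 - Q ^ (N + 1 - n)).
  by rewrite -inv_qfact_pred //; congr iQ; ring.
have -> : N - (n - 1) = N + 1 - n by ring.
have -> : (- x) ^ (n - 1) * q ^ ((n - 1) ^+ 2 - (n - 1))
    = (- x) ^ n / (- x) * (q ^ (n ^+ 2 - n) * Q / Q ^ n).
  rewrite (expfzDr n (-1) nx0) -(invr_expz (- x)) expr1z !qbase_exprz (exprnP q 2).
  by rewrite (invr_expz q) -!expfzDr //; congr (_ * _ ^ _); ring.
rewrite !(expfzDr _ _ (qbase_neq0 q0)) expr1z -(invr_expz Q n).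
have := expfz_neq0 n (qbase_neq0 q0).
move: (Q ^ n) (Q ^ M) (Q ^ N) ((- x) ^ n) (q ^ _) (iQ _) (iQ _).
by move=> X A Y B C i j X0; field; rewrite X0 x0.
Qed.

Lemma has_sum_triple_term_right (M N : nat) x s : x != 0 ->
  has_sum (triple_term x M 0) (s * iQ M) ->
  has_sum (triple_term x M N) (s * qpoch x Q N * iQ (M + N)%N).
Proof.
move=> x0 hs; elim: N => [|N IH]; first by rewrite qpoch0 mulr1 addn0.
have QMN : 1 - Q ^ (M%:Z + N%:Z + 1) != 0.
  by rewrite expfzDr ?qbase_neq0 // expr1z mulrC; apply: (q_not_root (M + N)).
have := has_sumB IH (has_sumZ (x * Q ^ N%:Z) (has_sum_shift (-1) IH)).
move=> /(has_sumZ (1 - Q ^ (M%:Z + N%:Z + 1))^-1).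
rewrite (_ : _ * (_ - _) = s * qpoch x Q N.+1 * iQ (M + N.+1)%N).
  apply: eq_has_sum => n; rewrite (_ : N.+1%:Z = N%:Z + 1); last by lia.
  by rewrite -triple_termS // mulKf.
rewrite (_ : (M + N.+1)%N%:Z = M%:Z + N%:Z + 1); last by lia.
rewrite (_ : N.+1%:Z = N%:Z + 1); last by lia.
rewrite qpochS; last exact: qpoch_wd_nat.
rewrite PoszD (inv_qfactS q0 q_not_root (M%:Z + N%:Z)).
move: QMN; move: (iQ _) (Q ^ (_ + 1)) (Q ^ N%:Z) (qpoch _ _ _) => i Y X d Y1.
by field.
Qed.

Lemma finite_triple_product (M N : nat) x : x != 0 ->
  has_sum (triple_term x M N) (qpoch (Q / x) Q M * qpoch x Q N * iQ (M + N)%N).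
Proof.
move=> x0; apply: has_sum_triple_term_right => //.
have Qx0 : Q / x != 0 by rewrite mulf_neq0 ?invr_eq0 ?qbase_neq0.
have : has_sum (triple_term (Q / x) 0 M) (1 * qpoch (Q / x) Q M * iQ (0 + M)%N).
  apply: has_sum_triple_term_right => //; rewrite mul1r.
  have -> : iQ 0 = triple_term (Q / x) 0 0 0.
    by rewrite -[RHS]/(1 * 1 * iQ 0 * iQ 0) inv_qfact0 !mul1r.
  apply: has_sum_single => n n0; rewrite /triple_term add0r sub0r.
  have [n_lt0|n_ge0] := ltP n 0; first by rewrite (inv_qfact_neg q0 n_lt0) mulr0 mul0r.
  by rewrite [iQ (- n)]inv_qfact_neg ?mulr0 //; lia.
rewrite mul1r add0n => /(has_sum_opp 0); apply: eq_has_sum => n.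
by rewrite sub0r -triple_term_opp opprK.
Qed.

End FiniteSums.

Section QSeriesSums.
Variables (R : realType) (q : R[i]).
Hypotheses (q0 : q != 0) (q1 : normc q < 1).
Local Notation C := (R[i] : numFieldType).
Local Notation Q := (q ^+ 2).
Local Notation iQ := (inv_qfact q).
Implicit Types (a b : R[i]).

Let Q0 : Q != 0. Proof. exact: qbase_neq0. Qed.
Let Q1 : normc Q < 1. Proof. exact: normc_qbase_lt1. Qed.
Let q_not_root j : 1 - Q * Q ^+ j != 0. Proof. exact: qbase_not_root. Qed.

Let scaleM_neq0 b (M : nat) : b != 0 -> b * Q ^+ M != 0.
Proof. by move=> b0; rewrite mulf_neq0 ?expf_neq0. Qed.

Section Phi11.
Variables (a b : R[i]).
Hypotheses (b0 : b != 0) (ab_neq : forall j, 1 - a * b * Q ^+ j != 0).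

Let term (M : nat) (n : int) : R[i] :=
  iQ n * (qpoch a Q n / qpoch (a * b * Q ^+ M) Q n) * ((- b) ^ n * q ^ (n ^+ 2 - n)).

Let gaussian_term :
  gaussian_bound q (fun p => absz p.2) (fun p => p.2 ^+ 2) (fun p => term p.1 p.2).
Proof.
have [A hA] := qpoch_bounded Q1 a; have [B hB] := qpochV_bounded Q1 Q0 ab_neq.
have nb0 : - b != 0 by rewrite oppr_eq0.
have h := gaussian_bound_inv_qfactM q0 q1 (B := A * B)
  (g := fun (M : nat) n => qpoch a Q n / qpoch (a * b * Q ^+ M) Q n).
apply: (gaussian_boundW q0 q1 (K := 2) (gaussian_boundM q0 (h _)
  (gaussian_boundM q0 (gaussian_bound_exprz q (fun p : nat * int => p.2) nb0)
     (gaussian_bound_qexprz q (fun p : nat * int => p.2 ^+ 2 - p.2))))).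
  by move=> M n; rewrite normcM ler_pM ?normc_ge0 // ?hA.
by move=> p _ /=; lia.
Qed.

Let term_neq0 M n : term M n != 0 -> 0 <= n /\ n ^+ 2 <= 1%:Z * n ^+ 2.
Proof.
rewrite mul1r; have [/(inv_qfact_neg q0) n0|//] := ltP n 0.
by rewrite /term n0 !mul0r eqxx.
Qed.

Lemma gaussian_bound_phi11 :
  gaussian_bound q absz (fun n => n ^+ 2) (phi11_term q a b).
Proof.
apply: eq_gaussian_bound (gaussian_bound_comp (fun n : int => (0%N, n)) gaussian_term) => n.
by rewrite /= -[b in RHS]mulr1 phi11_term_scale exp1rz mul1r.
Qed.

Lemma phi11_has_sum : exists s : C, has_sum (phi11_term q a b : int -> C) s.
Proof.
apply: (gaussian_bound_has_sum q0 q1 (K := 1) _ gaussian_bound_phi11) => // n _.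
by rewrite mul1r.
Qed.

Lemma phi11_sum_shift (s t : C) : has_sum (phi11_term q a b : int -> C) s ->
  has_sum (phi11_term q a (b * Q) : int -> C) t -> s = (1 - b) / (1 - a * b) * t.
Proof.
move=> hs ht.
have [//|n _|u hu] := gaussian_bound_has_sum q0 q1 (K := 1) _
  (gaussian_bound_exprzM q0 q1 Q0 gaussian_bound_phi11); first by rewrite mul1r.
have := has_sumD hu (has_sum_shift 1 (has_sumB hs hu)); rewrite addrC subrK => h.
apply: has_sum_unique h _; apply: eq_has_sum (has_sumZ _ ht) => n.
by rewrite -phi11_termS // mulrBl mul1r.
Qed.

Lemma phi11_scale_cvg (S : nat -> C) :
  (forall M, has_sum (phi11_term q a (b * Q ^+ M) : int -> C) (S M)) ->
  S @ \oo --> (1 : C).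
Proof.
move=> hS; apply: (has_sum_qscale_cvg q0 q1 (K := 1) _ gaussian_term term_neq0) => //.
  by move=> M; apply: eq_has_sum (hS M) => n; rewrite phi11_term_scale.
rewrite (_ : (fun M : nat => term M 0) = cst (1 : C)); first exact: cvg_cst.
by apply/funext => M; rewrite /term inv_qfact0 !qpoch0 invr1 !mul1r.
Qed.

End Phi11.

Lemma phi11_sum a b : b != 0 -> (forall j, 1 - a * b * Q ^+ j != 0) ->
  has_sum (phi11_term q a b : int -> C) (qpoch_inf b Q / qpoch_inf (a * b) Q).
Proof.
move=> b0 ab_neq; have abM M j : 1 - a * (b * Q ^+ M) * Q ^+ j != 0.
  by rewrite !mulrA -mulrA -exprD.
have /choice [S hS] : forall M, exists s : C,
    has_sum (phi11_term q a (b * Q ^+ M) : int -> C) s.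
  by move=> M; apply: phi11_has_sum; [exact: scaleM_neq0|exact: abM].
have SM (M : nat) : S 0%N * qpoch (a * b) Q M = qpoch b Q M * S M.
  elim: M => [|M IH]; first by rewrite !qpoch0 mulr1 mul1r.
  rewrite (_ : M.+1%:Z = M%:Z + 1); last by lia.
  rewrite !qpochS; try exact: qpoch_wd_nat.
  have hS' : has_sum (phi11_term q a (b * Q ^+ M * Q) : int -> C) (S M.+1).
    by rewrite -mulrA -exprSr.
  have := phi11_sum_shift (scaleM_neq0 M b0) (abM M) (hS M) hS'.
  have := abM M 0%N; rewrite expr0 mulr1 mulrA -!exprnP => abM0 SMS.
  by rewrite mulrA IH SMS; field.
have S0 : S 0%N * qpoch_inf (a * b) Q = qpoch_inf b Q * 1.
  apply: (num_cvg_unique (F := \oo) (u := fun M : nat => S 0%N * qpoch (a * b) Q M)).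
    by apply: cvgM; [exact: cvg_cst|exact: qpoch_inf_cvg].
  under eq_fun do rewrite SM; apply: cvgM; first exact: qpoch_inf_cvg.
  exact: (phi11_scale_cvg b0 ab_neq hS).
have -> : qpoch_inf b Q / qpoch_inf (a * b) Q = S 0%N.
  by rewrite -[qpoch_inf b Q]mulr1 -S0 mulfK // qpoch_inf_neq0.
by have := hS 0%N; rewrite expr0 mulr1.
Qed.

Section Phi65.
Variable b : R[i].
Hypothesis b0 : b != 0.

Let term (M : nat) (n : int) : R[i] :=
  iQ n * (qpoch ((b * Q ^+ M) ^+ 2) Q n * (1 + b * Q ^+ M * Q ^ n))
  * (b ^ n * q ^ (2 * n ^+ 2)).

Let normc_scale_le M : normc (b * Q ^+ M) <= normc b.
Proof. by rewrite normcM ler_piMr ?normc_ge0 // normcX exprn_ile1 ?normc_ge0 // ltW. Qed.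

Let gaussian_unilateral (T : Type) (g : T -> int -> R[i]) (B : R) :
  (forall t (n : nat), normc (g t n) <= B) ->
  gaussian_bound q (fun p => absz p.2) (fun p => p.2 ^+ 2)
    (fun p : T * int => iQ p.2 * g p.1 p.2 * (b ^ p.2 * q ^ (2 * p.2 ^+ 2))).
Proof.
move=> gB; apply: (gaussian_boundW q0 q1 (K := 2) (gaussian_boundM q0
  (gaussian_bound_inv_qfactM q0 q1 gB)
  (gaussian_boundM q0 (gaussian_bound_exprz q (fun p : T * int => p.2) b0)
     (gaussian_bound_qexprz q (fun p : T * int => 2 * p.2 ^+ 2))))) => p _ /=.
by have := sqr_ge0 p.2; lia.
Qed.

Let gaussian_term :
  gaussian_bound q (fun p => absz p.2) (fun p => p.2 ^+ 2) (fun p => term p.1 p.2).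
Proof.
have [B hB] := qpoch_bounded Q1 (b ^+ 2).
apply: (@gaussian_unilateral _ (fun (M : nat) n => qpoch ((b * Q ^+ M) ^+ 2) Q n
  * (1 + b * Q ^+ M * Q ^ n)) (B * (1 + normc b))) => M n.
have bM := normc_scale_le M; rewrite normcM ler_pM ?normc_ge0 //.
  by apply: hB; rewrite !normcX lerXn2r ?nnegrE ?normc_ge0.
rewrite (le_trans (ler_normcD _ _)) // normc1 lerD2l -exprnP -mulrA -exprD.
exact: normc_scale_le.
Qed.

Let term_neq0 M n : term M n != 0 -> 0 <= n /\ n ^+ 2 <= 1%:Z * n ^+ 2.
Proof.
rewrite mul1r; have [/(inv_qfact_neg q0) n0|//] := ltP n 0.
by rewrite /term n0 !mul0r eqxx.
Qed.

Lemma phi65_has_sum : exists s : C, has_sum (phi65_term q b : int -> C) s.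
Proof.
apply: (gaussian_bound_has_sum q0 q1 (K := 1) (e := fun n => n ^+ 2)) => // [|n _].
  apply: eq_gaussian_bound (gaussian_bound_comp (fun n : int => (0%N, n)) gaussian_term) => n.
  by rewrite /= -[b in RHS]mulr1 phi65_term_scale exp1rz mul1r.
by rewrite mul1r.
Qed.

Lemma phi65_cert_has_sum : exists s : C, has_sum (phi65_cert q b : int -> C) s.
Proof.
have [B hB] := qpoch_bounded Q1 (b ^+ 2).
pose g (_ : unit) n := (1 - Q ^ n) * (1 - b - b ^+ 2 * Q ^ n) * qpoch (b ^+ 2) Q n.
have g_le t (n : nat) : normc (g t n) <= 2 * (1 + normc b + normc b ^+ 2) * B.
  have Qn_le x : normc (x * Q ^ n%:Z) <= normc x.
    by rewrite normcM ler_piMr ?normc_ge0 // normcX exprn_ile1 ?normc_ge0 // ltW.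
  rewrite !normcM !ler_pM ?mulr_ge0 ?normc_ge0 ?hB //.
    rewrite (le_trans (ler_normcD _ _)) // normc1 normc_opp.
    by have := Qn_le 1; rewrite mul1r normc1; lra.
  rewrite (le_trans (ler_normcD _ _)) // lerD //.
    by rewrite (le_trans (ler_normcD _ _)) // normc1 normc_opp.
  by rewrite normc_opp -normcX.
have := gaussian_bound_comp (fun n : int => (tt, n)) (gaussian_unilateral g_le).
move=> /eq_gaussian_bound gcert.
apply: (gaussian_bound_has_sum q0 q1 (K := 1) _ (gcert _ _)) => // n; last by rewrite mul1r.
by rewrite /phi65_cert /g /=; ring.
Qed.

Lemma phi65_sum_shift (s t : C) : has_sum (phi65_term q b : int -> C) s ->
  has_sum (phi65_term q (b * Q) : int -> C) t ->
  (1 - b) * s = (1 - b ^+ 2) * (1 - b ^+ 2 * Q) * t.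
Proof.
move=> hs ht; have [u hu] := phi65_cert_has_sum.
apply: has_sum_unique (has_sum_telescope (has_sumZ (1 - b) hs) hu) _.
by apply: eq_has_sum (has_sumZ _ ht) => n; rewrite -phi65_termS.
Qed.

Lemma phi65_scale_cvg (S : nat -> C) :
  (forall M, has_sum (phi65_term q (b * Q ^+ M) : int -> C) (S M)) ->
  S @ \oo --> (1 : C).
Proof.
move=> hS; apply: (has_sum_qscale_cvg q0 q1 (K := 1) _ gaussian_term term_neq0) => //.
  by move=> M; apply: eq_has_sum (hS M) => n; rewrite phi65_term_scale.
rewrite (_ : (fun M : nat => term M 0)
  = cst (1 : C) \+ (cst (b : C) \* (fun M => Q ^+ M : C))).
  rewrite -[X in _ --> X]addr0 -(mulr0 (b : C)).
  apply: cvgD; first exact: cvg_cst.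
  by apply: cvgM; [exact: cvg_cst|exact: cvg_normc_expr].
by apply/funext => M; rewrite /term inv_qfact0 qpoch0 expr0z !mul1r !mulr1.
Qed.

End Phi65.

Lemma phi65_sum b : b != 0 -> (forall j, 1 - b * Q ^+ j != 0) ->
  has_sum (phi65_term q b : int -> C) (qpoch_inf (b ^+ 2) Q / qpoch_inf b Q).
Proof.
move=> b0 b_neq.
have /choice [S hS] : forall M, exists s : C,
    has_sum (phi65_term q (b * Q ^+ M) : int -> C) s.
  by move=> M; apply: phi65_has_sum; exact: scaleM_neq0.
have SM (M : nat) : S 0%N * qpoch b Q M = qpoch (b ^+ 2) Q (2 * M)%N * S M.
  elim: M => [|M IH]; first by rewrite !qpoch0 mulr1 mul1r.
  have hS' : has_sum (phi65_term q (b * Q ^+ M * Q) : int -> C) (S M.+1).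
    by rewrite -mulrA -exprSr.
  have SMS := phi65_sum_shift (scaleM_neq0 M b0) (hS M) hS'.
  rewrite (_ : (2 * M.+1)%N%:Z = (2 * M)%N%:Z + 1 + 1); last by lia.
  rewrite (_ : M.+1%:Z = M%:Z + 1); last by lia.
  rewrite !qpochS; try exact: qpoch_wd_nat.
  rewrite [LHS]mulrA IH -[LHS]mulrA [S M * _]mulrC -exprnP SMS.
  rewrite (expfzDr (2 * M)%N 1 Q0) expr1z -exprnP (mulnC 2 M) (exprM Q M 2) exprMn.
  by rewrite !mulrA.
have S0 : S 0%N * qpoch_inf b Q = qpoch_inf (b ^+ 2) Q * 1.
  apply: (num_cvg_unique (F := \oo) (u := fun M : nat => S 0%N * qpoch b Q M)).
    by apply: cvgM; [exact: cvg_cst|exact: qpoch_inf_cvg].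
  under eq_fun do rewrite SM; apply: cvgM; last exact: (phi65_scale_cvg b0 hS).
  apply: (cvg_int_comp (g := fun M : nat => (2 * M)%N%:Z) (k := 0)
    (@qpoch_inf_cvg _ _ Q1 (b ^+ 2))).
  by move=> M; lia.
have -> : qpoch_inf (b ^+ 2) Q / qpoch_inf b Q = S 0%N.
  by rewrite -[qpoch_inf (b ^+ 2) Q]mulr1 -S0 mulfK // qpoch_inf_neq0.
by have := hS 0%N; rewrite expr0 mulr1.
Qed.

End QSeriesSums.

(** * Jacobi's triple product *)

Section JacobiTripleProduct.
Variables (R : realType) (q x : R[i]).
Hypotheses (q0 : q != 0) (q1 : normc q < 1) (x0 : x != 0).
Local Notation C := (R[i] : numFieldType).
Local Notation Q := (q ^+ 2).
Local Notation iQ := (inv_qfact q).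

Let Q0 : Q != 0. Proof. exact: qbase_neq0. Qed.
Let Q1 : normc Q < 1. Proof. exact: normc_qbase_lt1. Qed.

Lemma inv_qfact_cvg (g : nat -> int) (k : int) : (forall n : nat, n%:Z + k <= g n) ->
  (iQ (g n) : C) @[n --> \oo] --> (qpoch_inf Q Q)^-1.
Proof.
apply: (cvg_int_comp (u := iQ : int -> C)).
exact: (qpochV_inf_cvg Q1 Q0 (qbase_not_root q1)).
Qed.

Lemma gaussian_bound_theta :
  gaussian_bound q absz (fun n => n ^+ 2) (fun n => (- x) ^ n * q ^ (n ^+ 2 - n)).
Proof.
have nx0 : - x != 0 by rewrite oppr_eq0.
apply: (gaussian_boundW q0 q1 (K := 1) (gaussian_boundM q0
  (gaussian_bound_exprz q id nx0) (gaussian_bound_qexprz q (fun n => n ^+ 2 - n)))).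
by move=> n _ /=; lia.
Qed.

Lemma gaussian_bound_triple_term :
  gaussian_bound q (fun p : nat * int => absz p.2) (fun p => p.2 ^+ 2)
    (fun p => triple_term q x p.1 p.1 p.2).
Proof.
have iQb := gaussian_bound_inv_qfact q0 q1.
apply: (gaussian_boundW q0 q1 (K := 1) (gaussian_boundM q0 (gaussian_boundM q0
  (gaussian_bound_comp (snd : nat * int -> int) gaussian_bound_theta)
  (gaussian_bound_comp (fun p : nat * int => p.1%:Z + p.2) iQb))
  (gaussian_bound_comp (fun p : nat * int => p.1%:Z - p.2) iQb))).
by move=> p _ /=; lia.
Qed.

Lemma jacobi_triple_product :
  has_sum (fun n => (- x) ^ n * q ^ (n ^+ 2 - n) : C)
    (qpoch_inf Q Q * (qpoch_inf x Q * qpoch_inf (Q / x) Q)).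
Proof.
have [//|n _|S hS] := gaussian_bound_has_sum q0 q1 (K := 1) _ gaussian_bound_theta.
  by rewrite mul1r.
have [//|N n _|b hb fb] := gaussian_bound_dominated q0 q1 (K := 1)
  (f := fun N : nat => triple_term q x N N) _ gaussian_bound_triple_term.
  by rewrite mul1r.
have limit_eq : qpoch_inf (Q / x) Q * qpoch_inf x Q * (qpoch_inf Q Q)^-1
    = (qpoch_inf Q Q)^-1 ^+ 2 * S.
  have hN (N : nat) := @finite_triple_product C q q0 (qbase_not_root q1) N N x x0.
  apply: (num_cvg_unique (F := \oo)
    (u := fun N : nat => qpoch (Q / x) Q N * qpoch x Q N * iQ (N + N)%N)).
    apply: cvgM; last by apply: (@inv_qfact_cvg (fun N => (N + N)%N%:Z) 0) => N; lia.
    by apply: cvgM; apply: qpoch_inf_cvg.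
  apply: (has_sum_dominated_cvg hb fb _ hN (has_sumZ _ hS)).
  move=> n; rewrite mulrC expr2 mulrA; apply: cvgM.
    apply: cvgM; first exact: cvg_cst.
    by apply: (@inv_qfact_cvg (fun N => N%:Z + n) n).
  by apply: (@inv_qfact_cvg (fun N => N%:Z - n) (- n)).
have Qi0 : qpoch_inf Q Q != 0 by apply: qpoch_inf_neq0 (qbase_not_root q1).
rewrite (_ : _ * _ = S) //; apply: (mulfI (expf_neq0 2 (invr_neq0 Qi0))).
by rewrite -limit_eq expr2 mulrA mulrVK ?unitfE // mulrC [qpoch_inf x Q * _]mulrC.
Qed.

End JacobiTripleProduct.

(** * Bailey's transform *)

Section Monomials.
Variables (F : fieldType) (q z : F).
Hypotheses (q0 : q != 0) (z0 : z != 0).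

Definition monomial (e a c : int) : F := (-1) ^ e * z ^ a * q ^ c.

Lemma monomialM e a c e' a' c' :
  monomial e a c * monomial e' a' c' = monomial (e + e') (a + a') (c + c').
Proof.
have sign_neq0 : -1 != 0 :> F by rewrite oppr_eq0 oner_eq0.
by rewrite /monomial (expfzDr e) // (expfzDr a) // (expfzDr c) //; ring.
Qed.

Lemma monomialXz e a c n : monomial e a c ^ n = monomial (e * n) (a * n) (c * n).
Proof. by rewrite /monomial !(expfzMl _ _ n) !exprz_exp. Qed.

Lemma monomialV e a c : (monomial e a c)^-1 = monomial (- e) (- a) (- c).
Proof. by rewrite -[X in X^-1]expr1z invr_expz monomialXz !mulrN1. Qed.

Lemma monomial_z a : z ^ a = monomial 0 a 0.
Proof. by rewrite /monomial !expr0z mul1r mulr1. Qed.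

Lemma monomial_q c : q ^ c = monomial 0 0 c.
Proof. by rewrite /monomial !expr0z !mul1r. Qed.

Lemma monomialN e a c : - monomial e a c = monomial (1 + e) a c.
Proof.
rewrite /monomial expfzDr ?oppr_eq0 ?oner_eq0 // expr1z.
by rewrite -!mulrA !mulN1r.
Qed.

End Monomials.

Section BaileyKernel.
Variables (K : numFieldType) (q z : K).
Hypotheses (q0 : q != 0) (z0 : z != 0).
Local Notation Q := (q ^+ 2).
Hypothesis z2_regular : qregular Q (z ^+ 2).
Hypothesis q_not_root : forall j, 1 - Q * Q ^+ j != 0.
Local Notation iQ := (inv_qfact q).
Implicit Types (n s N j : int) (g : int -> K).

Let Q0 : Q != 0. Proof. exact: qbase_neq0. Qed.

Let z2Q_regular : qregular Q (z ^+ 2 * Q).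
Proof. exact: (qregularM Q0 1). Qed.

Definition bailey_kernel N n : K := iQ (N - n) / qpoch (z ^+ 2 * Q) Q (N + n).
Local Notation ker := bailey_kernel.

Lemma bailey_kernel_lt N n : N < n -> ker N n = 0.
Proof. by move=> Nn; rewrite /ker inv_qfact_neg ?mul0r // subr_lt0. Qed.

(* Since [u_n^2 = z^(2 n) Q^(n^2)], the weights of the Bailey lemma are [u^2]. *)
Definition theta_weight n : K := z ^ n * q ^ (n ^+ 2).
Local Notation u := theta_weight.

Definition outer_weight s : K := qpoch (- z * q) Q s * u s.

Lemma theta_weight_neq0 n : u n != 0.
Proof. by rewrite mulf_neq0 ?expfz_neq0. Qed.

Lemma theta_weightD n j : u (n + j) = u n * ((z * Q ^ n) ^ j * q ^ (j ^+ 2)).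
Proof.
rewrite /u (expfzMl z) qbase_exprz exprz_exp (expfzDr _ _ z0).
have -> : (n + j) ^+ 2 = n ^+ 2 + 2 * n * j + j ^+ 2 by ring.
by rewrite !(expfzDr _ _ q0); move: (z ^ n) (z ^ j) => *; ring.
Qed.

Lemma qpoch_kernel_shift n j :
  iQ j / qpoch (z ^+ 2 * Q) Q (n + n + j)
  = (qpoch (z ^+ 2 * Q) Q (n + n))^-1 * (iQ j / qpoch ((z * q * Q ^ n) ^+ 2) Q j).
Proof.
case: j => j; last by rewrite inv_qfact_neg // !mul0r mulr0.
rewrite qpochD //; last exact: qregular_wd.
rewrite (_ : z ^+ 2 * Q * Q ^ (n + n) = (z * q * Q ^ n) ^+ 2); last first.
  by rewrite (expfzDr _ _ Q0); ring.
by rewrite invfM; ring.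
Qed.

Lemma theta_weight_sqr_kernel N n j :
  u (n + j) ^+ 2 * iQ (N - (n + j)) * ker (n + j) n
  = u n ^+ 2 / qpoch (z ^+ 2 * Q) Q (n + n)
    * qcv_term q (N - n) (z ^+ 2 * Q ^ (n + n)) j.
Proof.
rewrite /ker addrAC subrr add0r addrAC qpoch_kernel_shift /qcv_term.
have -> : z ^+ 2 * Q ^ (n + n) * Q = (z * q * Q ^ n) ^+ 2.
  by rewrite (expfzDr _ _ Q0); ring.
have -> : N - (n + j) = N - n - j by ring.
have -> : (z ^+ 2 * Q ^ (n + n)) ^ j * q ^ (2 * j ^+ 2)
    = ((z * Q ^ n) ^ j * q ^ (j ^+ 2)) ^+ 2.
  rewrite exprMn (_ : z ^+ 2 * Q ^ (n + n) = (z * Q ^ n) ^+ 2); last first.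
    by rewrite (expfzDr _ _ Q0); ring.
  by rewrite !exprnP !exprz_exp ![_ * 2]mulrC.
rewrite theta_weightD; move: (u n) (_ * q ^ _) (qpoch _ _ _)^-1 (qpoch _ _ _)^-1 => *.
by ring.
Qed.

Lemma bailey_kernel_layer N n :
  has_sum (fun s => u s ^+ 2 * iQ (N - s) * ker s n) (u n ^+ 2 * ker N n).
Proof.
set a := z ^+ 2 * Q ^ (n + n).
have a0 : a != 0 by rewrite mulf_neq0 ?expf_neq0 ?expfz_neq0.
have aQ_neq (j : nat) : 1 - a * Q * Q ^+ j != 0.
  by rewrite -mulrA -exprS (exprnP Q); apply: qregularM.
have := @q_chu_vandermonde K q q0 q_not_root (N - n) a a0 aQ_neq.
move=> /(has_sumZ (u n ^+ 2 / qpoch (z ^+ 2 * Q) Q (n + n))) /(has_sum_shift (- n)).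
rewrite (_ : _ * (_ / _) = u n ^+ 2 * ker N n).
  by apply: eq_has_sum => s; rewrite -theta_weight_sqr_kernel addrC subrK.
rewrite /ker (_ : N + n = n + n + (N - n)); last by ring.
rewrite qpoch_kernel_shift (_ : a * Q = (z * q * Q ^ n) ^+ 2) ?mulrA //.
by rewrite /a (expfzDr _ _ Q0); ring.
Qed.

Lemma outer_weight_kernel n j : qpoch_wd (- z * q) Q n ->
  outer_weight (n + j) * ker (n + j) n
  = outer_weight n / qpoch (z ^+ 2 * Q) Q (n + n)
    * phi11_term q (- (z * q * Q ^ n)) (- (z * q * Q ^ n)) j.
Proof.
move=> wd; rewrite /outer_weight /ker addrAC subrr add0r addrAC qpoch_kernel_shift.
rewrite /phi11_term.
case: j => j; last by rewrite inv_qfact_neg // !(mul0r, mulr0).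
rewrite qpochD // theta_weightD mulrNN -expr2 opprK.
have -> : - z * q * Q ^ n = - (z * q * Q ^ n) by ring.
have -> : (z * q * Q ^ n) ^ j%:Z * q ^ (j%:Z ^+ 2 - j%:Z)
    = (z * Q ^ n) ^ j%:Z * q ^ (j%:Z ^+ 2).
  rewrite (mulrAC z q) (expfzMl _ q) -mulrA -expfzDr //.
  by congr (_ * _ ^ _); ring.
by ring.
Qed.

Local Notation mon := (monomial q z).

Lemma theta_weight_monomial n : u n = mon 0 n (n ^+ 2).
Proof. by rewrite /monomial expr0z mul1r. Qed.

(* [level m n = (-1)^n u_n^(2 m + 3) q^((2 m + 1) n)] *)
Definition level (m n : int) : K :=
  mon n ((2 * m + 3) * n) ((2 * m + 3) * n ^+ 2 + (2 * m + 1) * n).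

Definition qdiff g n : K := g n - z ^+ 2 * Q ^ (2 * n - 1) * g (n - 1).

Lemma qdiff_level m n :
  qdiff (level m) n = level m n + mon n ((2 * m + 3) * n - (2 * m + 1))
    ((2 * m + 3) * n ^+ 2 - (2 * m + 1) * n).
Proof.
rewrite /qdiff /level; congr (_ + _).
rewrite qbase_exprz (exprnP z) (monomial_z q z) (monomial_q q z) !monomialM //.
rewrite monomialN.
by congr monomial; ring.
Qed.

Lemma qdiff_levelS m n :
  u n ^+ 2 * (Q ^ n * level m n - Q ^ (n - 1) * level m (n - 1))
  = qdiff (level (m + 1)) n.
Proof.
rewrite qdiff_level mulrBr -mulrN theta_weight_monomial !qbase_exprz /level.
rewrite (exprnP (mon _ _ _)) monomialXz !(monomial_q q z).
rewrite !(monomialN, monomialM) //.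
by congr (monomial _ _ _ _ _ + monomial _ _ _ _ _); ring.
Qed.

Lemma bailey_kernel_telescope g s n (h := fun n => (Q ^ n - Q ^ s) * g n * ker s n) :
  (Q ^ n * g n - Q ^ (n - 1) * g (n - 1)) * ker s n
  = Q ^ s * (qdiff g n * ker s n) - h (n - 1) + h n.
Proof.
rewrite /h /qdiff /ker.
have -> : iQ (s - n) = iQ (s - (n - 1)) * (1 - Q ^ (s - (n - 1))).
  by rewrite -inv_qfact_pred //; congr iQ; ring.
have -> : (qpoch (z ^+ 2 * Q) Q (s + (n - 1)))^-1
    = (qpoch (z ^+ 2 * Q) Q (s + n))^-1 * (1 - z ^+ 2 * Q ^ (s + n)).
  rewrite qpochVS // (_ : s + (n - 1) + 1 = s + n); last by ring.
  congr (_ * (1 - _)); rewrite -mulrA -[X in X * _ ^ _]expr1z -expfzDr //.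
  by congr (_ * _ ^ _); ring.
rewrite (_ : s - (n - 1) = s - n + 1); last by ring.
rewrite (_ : 2 * n - 1 = n + n - 1); last by ring.
rewrite !(expfzDr _ _ Q0) -![Q ^ (- _)]invr_expz expr1z.
have := expfz_neq0 n Q0; have := expfz_neq0 s Q0.
move: (Q ^ n) (Q ^ s) (g n) (g _) (iQ _) (qpoch _ _ _)^-1 => X Y a b c d Y0 X0.
by field; rewrite X0 q0.
Qed.

Lemma qpochV_reflect m :
  (qpoch (z ^+ 2 * Q) Q m)^-1
  = mon (- m) (- 2 * m) (- (m ^+ 2 + m)) * qpoch (z ^- 2) Q (- m).
Proof.
have z2Q0 : z ^+ 2 * Q != 0 by rewrite mulf_neq0 ?expf_neq0.
have Qz : Q / (z ^+ 2 * Q) = z ^- 2 by rewrite invfM mulrCA mulfV ?mulr1.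
have wd n : qpoch_wd (z ^- 2) Q n by apply: qregular_wd; apply: qregularV.
have := qpoch_reflect q0 z2Q0 (qregular_wd (n := m) z2Q_regular).
rewrite Qz => /(_ (wd _)) e.
have -> : mon (- m) (- 2 * m) (- (m ^+ 2 + m))
    = ((- (z ^+ 2 * Q)) ^ m * q ^ (m ^+ 2 - m))^-1.
  rewrite (exprnP z) (exprnP q) !(monomial_z q z, monomial_q q z) !monomialM //.
  by rewrite monomialN monomialXz monomialM // monomialV; congr monomial; ring.
rewrite -e invfM divfK //.
by apply: qregular_neq0; apply: qregularV.
Qed.

Lemma base_alpha_kernel N j :
  qdiff (level 0) (N - j) * ker N (N - j)
  = mon (- N) (- N) (- (N ^+ 2 + N)) * qpoch (z ^- 2) Q (- (N + N))
    * phi65_term q (z^-1 * Q ^ (- N)) j.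
Proof.
rewrite qdiff_level /ker subKr qpochV_reflect /phi65_term.
case: j => j; last by rewrite inv_qfact_neg // !(mul0r, mulr0).
set w := mon (- _) (- 2 * _) _.
rewrite (_ : - (N + (N - j%:Z)) = - (N + N) + j%:Z); last by ring.
rewrite qpochD //; last by apply: qregular_wd; apply: qregularV.
rewrite (_ : z ^- 2 * Q ^ (- (N + N)) = (z^-1 * Q ^ (- N)) ^+ 2); last first.
  by rewrite opprD (expfzDr _ _ Q0) exprMn exprVn expr2.
set b := z^-1 * Q ^ (- N); set n := N - j%:Z.
have bE : b = mon 0 (- 1) (- (2 * N)).
  by rewrite /b qbase_exprz -(exprN1 z) (monomial_z q z) (monomial_q q z)
    monomialM //; congr monomial; ring.
have -> : level 0 n + mon n ((2 * 0 + 3) * n - (2 * 0 + 1))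
    ((2 * 0 + 3) * n ^+ 2 - (2 * 0 + 1) * n)
  = mon n (3 * n) (3 * n ^+ 2 + n) * (1 + b * Q ^ j%:Z).
  rewrite [RHS]mulrDr mulr1 /level bE qbase_exprz (monomial_q q z) !monomialM //.
  by congr (monomial _ _ _ _ _ + monomial _ _ _ _ _); rewrite /n; ring.
have mon_eq : mon n (3 * n) (3 * n ^+ 2 + n) * w
  = mon (- N) (- N) (- (N ^+ 2 + N)) * (b ^ j%:Z * q ^ (2 * j%:Z ^+ 2)).
  rewrite /w bE monomialXz (monomial_q q z) !monomialM //.
  by congr monomial; rewrite /n; ring.
transitivity (mon n (3 * n) (3 * n ^+ 2 + n) * w
    * (iQ j * qpoch (z ^- 2) Q (- (N + N)) * qpoch (b ^+ 2) Q j * (1 + b * Q ^ j%:Z))).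
  by ring.
by rewrite mon_eq; ring.
Qed.

End BaileyKernel.

Section ChainTerms.
Variables (K : numFieldType) (q z : K).
Hypotheses (q0 : q != 0) (z0 : z != 0).
Local Notation Q := (q ^+ 2).
Local Notation iQ := (inv_qfact q).
Local Notation u := (theta_weight q z).
Local Notation mon := (monomial q z).
Variable i : nat.
Implicit Types (N s n c : int) (k : seq int).

Definition linear_factor (j : nat) s : K := if (i <= j)%N then Q ^ s else 1.
Local Notation lin := linear_factor.

(* [chain j N [:: k_j; k_(j+1); ...]] is the part of the summand that depends on
   [k_j, k_(j+1), ...], when [k_(j-1) = N]. *)
Fixpoint chain (j : nat) N k : K :=
  if k is s :: k' then iQ (N - s) * (u s ^+ 2 * lin j s * chain j.+1 s k')
  else (qpoch (z * Q) Q N)^-1.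

Lemma chain_path j N k : chain j N k != 0 -> path >=%R N k.
Proof.
elim: k j N => //= s k IH j N; rewrite !mulf_eq0 !negb_or.
move=> /and3P[iQ_neq0 _ /IH ->]; rewrite andbT.
by rewrite leNgt; apply: contra iQ_neq0 => Ns; rewrite inv_qfact_neg // subr_lt0.
Qed.

Lemma linear_factorE j s : lin j s = q ^ (2 * (if (i <= j)%N then s else 0)).
Proof. by rewrite /lin; case: ifP => _; rewrite ?qbase_exprz // mulr0 expr0z. Qed.

Lemma theta_weight_sqrE s : u s ^+ 2 = z ^ (2 * s) * q ^ (2 * s ^+ 2).
Proof. by rewrite exprMn !exprnP !exprz_exp ![2 * _]mulrC. Qed.

Lemma chainE j N k : chain j N k =
  z ^ (2 * \sum_(l < size k) k`_l)
  * q ^ (2 * (\sum_(l < size k) k`_l ^+ 2)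
         + 2 * (\sum_(l < size k) if (i <= j + l)%N then k`_l else 0))
  / (qpoch (z * Q) Q (last N k)
     * \prod_(l < size k) qpoch Q Q ((N :: k)`_l - k`_l)).
Proof.
elim: k j N => [|s k IH] j N.
  by rewrite /= !big_ord0 !mulr0 addr0 !expr0z !mul1r mulr1.
rewrite /= IH !big_ord_recl /= addn0.
have -> : \sum_(l < size k) (if (i <= j.+1 + l)%N then k`_l else 0)
   = \sum_(l < size k) (if (i <= j + bump 0 l)%N then k`_l else 0).
  by apply: eq_bigr => l _; rewrite addSnnS.
rewrite linear_factorE theta_weight_sqrE /inv_qfact.
rewrite !mulrDr !(expfzDr _ _ z0) !(expfzDr _ _ q0) !invfM.
move: (\sum_(l < size k) _) (\sum_(l < size k) _) (\sum_(l < size k) _) => a b c.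
by move: (\prod_(l < size k) _)^-1 (qpoch _ _ _)^-1 (qpoch _ _ _)^-1 => *; ring.
Qed.

(* The left side is the summand of the theorem, with [A] for the q-shifted
   factorial in its numerator and the indices starting from 1. *)
Lemma summand_chain A s k : (1 <= i)%N ->
  A * q ^ (2 * (\sum_(1 <= j < (size k).+2) (s :: k)`_j.-1 ^+ 2)
         + 2 * (\sum_(i <= j < (size k).+2) (s :: k)`_j.-1))
  / (qpoch (z * Q) Q (s :: k)`_(size k)
     * \prod_(1 <= j < (size k).+1) qpoch Q Q ((s :: k)`_j.-1 - (s :: k)`_j))
  * z ^ (2 * (\sum_(1 <= j < (size k).+2) (s :: k)`_j.-1))
  = A * u s ^+ 2 * lin 1 s * chain 2 s k.
Proof.
move=> i1; rewrite chainE (nth_last 0 (s :: k) : (s :: k)`_(size k) = _) /=.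
rewrite (big_nat_widenl _ _ _ _ _ i1) [X in 2 * _ + 2 * X]big_mkcond /= !big_add1 /=.
rewrite !big_mkord !big_ord_recl /= linear_factorE theta_weight_sqrE.
have -> : \sum_(l < size k) (if (i <= (bump 0 l).+1)%N then k`_l else 0)
   = \sum_(l < size k) (if (i <= 2 + l)%N then k`_l else 0) by [].
rewrite !mulrDr !(expfzDr _ _ z0) !(expfzDr _ _ q0) !invfM.
move: (\sum_(l < size k) _) (\sum_(l < size k) _) (\sum_(l < size k) _) => a b c.
by move: (\prod_(l < size k) _)^-1 (qpoch _ _ _)^-1 => *; ring.
Qed.

Lemma outer_weightE s : qpoch_wd (- z * q) Q s ->
  qpoch (- q ^ (1 - 2 * s) / z) Q s * u s ^+ 2 = outer_weight q z s.
Proof.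
move=> wd; have zq0 : - z * q != 0 by rewrite mulf_neq0 ?oppr_eq0.
have -> : - q ^ (1 - 2 * s) / z = q ^ (2 - 2 * s) / (- z * q).
  rewrite (_ : 2 - 2 * s = 1 - 2 * s + 1); last by ring.
  by rewrite (expfzDr _ 1 q0) expr1z; field; rewrite q0 z0.
rewrite (qpoch_reverse q0 zq0 wd) /outer_weight mulNr opprK.
rewrite -[X in X ^ (- s) * _](_ : mon 0 1 1 = _); last first.
  by rewrite /monomial expr0z mul1r !expr1z.
rewrite monomialXz (monomial_q q z (_ - _)) theta_weight_monomial monomialM //.
rewrite (exprnP (mon _ _ _)) monomialXz mulrAC monomialM // mulrC.
by congr (_ * monomial _ _ _ _ _); ring.
Qed.

Variable r : nat.

(* The Bailey pair reached once [k_j, ..., k_(r-1)] have been summed over. *)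
Definition chain_alpha (j : nat) n : K :=
  u n ^+ (2 * (i - j)) * qdiff q z (level q z (r - maxn i j)%N) n.

Definition theta_term c n : K :=
  (- (z ^+ (2 * r) * q ^ c)) ^ n * (q ^+ (2 * r)) ^ (n ^+ 2 - n).

Lemma theta_term_monomial c n :
  theta_term c n = mon n (2 * r%:Z * n) (c * n + 2 * r%:Z * (n ^+ 2 - n)).
Proof.
rewrite /theta_term !(exprnP _ (2 * r)) (monomial_z q z) !(monomial_q q z).
rewrite !monomialM // monomialN !monomialXz monomialM //.
by congr monomial; rewrite ?PoszM; ring.
Qed.

Definition theta_pair n : K :=
  theta_term (4 * r%:Z + 1 - 2 * i%:Z) n
  + z ^ (2 * i%:Z - 1 - 2 * r%:Z) * theta_term (2 * i%:Z - 1) n.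

Lemma chain_alpha1 n : (1 <= i <= r)%N -> chain_alpha 1 n = u n * theta_pair n.
Proof.
move=> /andP[i1 ir]; rewrite /chain_alpha (maxn_idPl i1) qdiff_level // /level.
rewrite /theta_pair !theta_term_monomial theta_weight_monomial (monomial_z q z).
rewrite (exprnP (mon _ _ _)) monomialXz !mulrDr !monomialM //.
have [-> ->] : (2 * (i - 1))%N%:Z = 2 * i%:Z - 2 /\ (r - i)%N%:Z = r%:Z - i%:Z by lia.
by congr (monomial _ _ _ _ _ + monomial _ _ _ _ _); ring.
Qed.

End ChainTerms.

Section BaileyPairs.
Variables (R : realType) (q z : R[i]).
Hypotheses (q0 : q != 0) (q1 : normc q < 1) (z0 : z != 0).
Local Notation C := (R[i] : numFieldType).
Local Notation Q := (q ^+ 2).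
Hypothesis z2_regular : qregular Q (z ^+ 2).
Local Notation iQ := (inv_qfact q).
Local Notation ker := (bailey_kernel q z).
Local Notation u := (theta_weight q z).
Local Notation outer := (outer_weight q z).
Implicit Types (n s N : int) (al be v g : int -> C).

(* With these bounds, the exponents of [q] in [al n * v s * bailey_kernel q z s n]
   add up to at least [(|n| + |s|)^2 / 8] on the support [n <= s] of the kernel. *)
Definition alpha_bound al := gaussian_bound q absz (fun n => 3 * n ^+ 2) al.
Definition weight_bound v := gaussian_bound q absz (fun s => s ^+ 2 + neg_sqr s) v.

Let Q0 : Q != 0. Proof. exact: qbase_neq0. Qed.
Let Q1 : normc Q < 1. Proof. exact: normc_qbase_lt1. Qed.
Let z2Q_regular : qregular Q (z ^+ 2 * Q). Proof. exact: (qregularM Q0 1). Qed.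
Let z2V_regular : qregular Q (z ^- 2). Proof. exact: qregularV. Qed.
Let z_regular : qregular Q z. Proof. exact: qregular_sqr. Qed.
Let zV_regular : qregular Q z^-1. Proof. exact: qregularV. Qed.

Lemma outer_weight_sum n : (forall s, qpoch_wd (- z * q) Q s) ->
  has_sum (fun s => outer s * ker s n : C)
    (qpoch_inf (- z * q) Q / qpoch_inf (z ^+ 2 * Q) Q * u n).
Proof.
move=> wd; set y := z * q * Q ^ n.
have y0 : - y != 0 by rewrite oppr_eq0 !mulf_neq0 ?expfz_neq0.
have yy : - y * - y = z ^+ 2 * Q * Q ^ (n + n).
  by rewrite /y (expfzDr _ _ Q0); ring.
have y_neq (j : nat) : 1 - - y * - y * Q ^+ j != 0.
  by rewrite yy; apply: qregular_nat; apply: qregularM.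
have := has_sumZ (qpoch (- z * q) Q n * u n / qpoch (z ^+ 2 * Q) Q (n + n))
  (@phi11_sum _ q q0 q1 (- y) (- y) y0 y_neq).
move=> /(has_sum_shift (- n)).
rewrite yy (qpoch_inf_shift Q1 Q0 (x := - z * q) (wd n)).
rewrite (qpoch_inf_shift Q1 Q0 (x := z ^+ 2 * Q) (m := n + n)); last exact: qregular_wd.
rewrite (_ : - z * q * Q ^ n = - y); last by rewrite /y !mulNr.
rewrite (_ : _ * (_ / _) = qpoch (- z * q) Q n * qpoch_inf (- y) Q /
  (qpoch (z ^+ 2 * Q) Q (n + n) * qpoch_inf (z ^+ 2 * Q * Q ^ (n + n)) Q) * u n).
  apply: eq_has_sum => s; rewrite -(outer_weight_kernel q0 z0 z2_regular) //.
  by rewrite [n + _]addrC subrK.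
by rewrite invfM; ring.
Qed.

Lemma base_bailey_sum N :
  has_sum (fun n => qdiff q z (level q z 0) n * ker N n : C)
    (qpoch_inf (z ^- 2) Q / qpoch_inf z^-1 Q / qpoch (z * Q) Q N).
Proof.
set b := z^-1 * Q ^ (- N).
have b0 : b != 0 by rewrite mulf_neq0 ?invr_eq0 ?expfz_neq0.
have b_neq (j : nat) : 1 - b * Q ^+ j != 0 by apply: qregular_nat; apply: qregularM.
have := has_sumZ (monomial q z (- N) (- N) (- (N ^+ 2 + N))
  * qpoch (z ^- 2) Q (- (N + N))) (@phi65_sum _ q q0 q1 b b0 b_neq).
move=> /(has_sum_opp N).
rewrite (_ : _ * (_ / _) = qpoch_inf (z ^- 2) Q / qpoch_inf z^-1 Q / qpoch (z * Q) Q N).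
  by apply: eq_has_sum => n; rewrite -base_alpha_kernel // subKr.
have wd x n : qregular Q x -> qpoch_wd x Q n by move=> xQ; apply: qregular_wd.
rewrite (qpoch_inf_shift Q1 Q0 (wd _ (- (N + N)) z2V_regular)).
rewrite (qpoch_inf_shift Q1 Q0 (wd _ (- N) zV_regular)) -/b.
have -> : z ^- 2 * Q ^ (- (N + N)) = b ^+ 2.
  by rewrite opprD (expfzDr _ _ Q0) /b exprMn exprVn expr2.
have zQ0 : z * Q != 0 by rewrite mulf_neq0.
have QzQ : Q / (z * Q) = z^-1 by rewrite invfM mulrCA mulfV ?mulr1.
have := qpoch_reflect q0 zQ0 (wd _ N (qregularM Q0 1 z_regular)).
rewrite QzQ => /(_ (wd _ _ zV_regular)) zQ_reflect.
have -> : monomial q z (- N) (- N) (- (N ^+ 2 + N))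
    = (qpoch (z * Q) Q N * qpoch z^-1 Q (- N))^-1.
  rewrite zQ_reflect -[in RHS](expr1z z) (monomial_z q z) (exprnP q).
  rewrite !(monomial_q q z) monomialM // monomialN monomialXz monomialM // monomialV.
  by congr monomial; ring.
by rewrite !invfM; ring.
Qed.

Lemma gaussian_bound_monomial (I : Type) (e a c : I -> int) :
  gaussian_bound q (fun i => absz (a i)) c (fun i => monomial q z (e i) (a i) (c i)).
Proof.
have hs : gaussian_bound q (fun=> 0%N) (fun=> 0) (fun i => (-1) ^ e i : R[i]).
  apply: (@bounded_gaussian_bound _ _ _ _ 1) => i.
  by rewrite normcXz normc_opp normc1 exp1rz.
apply: (gaussian_boundW q0 q1 (K := 1) (gaussian_boundM q0 (gaussian_boundM q0 hs
  (gaussian_bound_exprz q a z0)) (gaussian_bound_qexprz q c))) => i _ /=.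
by lia.
Qed.

Lemma alpha_bound_level (m : nat) : alpha_bound (level q z m).
Proof.
apply: (gaussian_boundW q0 q1 (K := 2 * m + 3) (gaussian_bound_monomial id
  (fun n => (2 * m%:Z + 3) * n)
  (fun n => (2 * m%:Z + 3) * n ^+ 2 + (2 * m%:Z + 1) * n))) => n _.
by split; rewrite ?expr2; nia.
Qed.

Let gaussian_kernel : gaussian_bound q (fun p : int * int => absz p.1 + absz p.2)%N
  (fun p => - neg_sqr (p.2 + p.1)) (fun p => ker p.2 p.1).
Proof.
have z2Q0 : z ^+ 2 * Q != 0 by rewrite mulf_neq0 ?expf_neq0.
have iQb := gaussian_bound_inv_qfact q0 q1.
have iAb := gaussian_bound_qpochV q0 q1 z2Q0 z2Q_regular.
apply: (gaussian_boundW q0 q1 (K := 1) (gaussian_boundM q0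
  (gaussian_bound_comp (fun p : int * int => p.2 - p.1) iQb)
  (gaussian_bound_comp (fun p : int * int => p.2 + p.1) iAb))).
by move=> p _ /=; lia.
Qed.

Lemma bounded_sums_bailey al v :
  alpha_bound al -> weight_bound v ->
  exists2 b : int * int -> R, bounded_sums b &
    forall n s, normc (al n * v s * ker s n) <= b (n, s).
Proof.
move=> hal hv.
have h := gaussian_boundM q0 (gaussian_boundM q0
  (gaussian_bound_comp (fst : int * int -> int) hal)
  (gaussian_bound_comp (snd : int * int -> int) hv)) gaussian_kernel.
have {}h : gaussian_bound q (fun p : int * int => absz p.1 + absz p.2)%N
   (fun p => 3 * p.1 ^+ 2 + (p.2 ^+ 2 + neg_sqr p.2) - neg_sqr (p.2 + p.1))
   (fun p => al p.1 * v p.2 * ker p.2 p.1).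
  by apply: (gaussian_boundW q0 q1 (K := 2) h) => p _ /=; lia.
have [//|[n s] /= alvk|B B0 hB] := gaussian_bound_geometric q0 q1 (K := 8) _ h.
  have {alvk} ns : n <= s.
    by rewrite leNgt; apply: contra alvk => /bailey_kernel_lt ->; rewrite ?mulr0.
  by rewrite /neg_sqr !expr2; case: ifP => s0; case: ifP => sn0; nia.
exists (fun p => B * (2^-1 ^+ absz p.1 * 2^-1 ^+ absz p.2)).
  have half0 (n : int) : 0 <= 2^-1 ^+ absz n :> R by rewrite exprn_ge0 ?invr_ge0.
  apply: bounded_sumsZ => //.
  exact: (bounded_sumsM half0 half0 (bounded_sums_half R) (bounded_sums_half R)).
by move=> n s; have := hB (n, s); rewrite /= exprD.
Qed.

Definition bailey_pair al be :=
  alpha_bound al /\ forall N, has_sum (fun n => al n * ker N n : C) (be N).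

Lemma base_bailey_pair : bailey_pair (qdiff q z (level q z 0))
  (fun N => qpoch_inf (z ^- 2) Q / qpoch_inf z^-1 Q / qpoch (z * Q) Q N).
Proof.
split; last exact: base_bailey_sum.
rewrite (_ : qdiff q z _ = fun n => level q z 0 n
    + monomial q z n ((2 * 0 + 3) * n - (2 * 0 + 1))
       ((2 * 0 + 3) * n ^+ 2 - (2 * 0 + 1) * n)).
  apply: gaussian_boundD (alpha_bound_level 0) _.
  apply: (gaussian_boundW q0 q1 (K := 4) (gaussian_bound_monomial _ _ _)) => n _ /=.
  by rewrite ?expr2; lia.
by apply/funext => n; apply: qdiff_level.
Qed.

Lemma bailey_pair_exchange al be v la : bailey_pair al be -> weight_bound v ->
  (forall n, has_sum (fun s => v s * ker s n : C) (la n)) ->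
  exists S, has_sum (fun s => v s * be s : C) S /\ has_sum (fun n => al n * la n : C) S.
Proof.
move=> [hal hbe] hv hla; have [b hb alvk] := bounded_sums_bailey hal hv.
have [n|s|S [hS1 hS2]] := has_sum_exchange hb
  (f := fun n s => al n * v s * ker s n) alvk
  (g := fun n => al n * la n) (h := fun s => v s * be s).
- by apply: eq_has_sum (has_sumZ (al n) (hla n)) => s; rewrite mulrA.
- by apply: eq_has_sum (has_sumZ (v s) (hbe s)) => n; rewrite mulrA [v s * _]mulrC.
by exists S.
Qed.

Lemma gaussian_bound_theta_weight_sqr :
  gaussian_bound q absz (fun s => 2 * s ^+ 2) (fun s => u s ^+ 2).
Proof.
have h := gaussian_boundM q0 (gaussian_bound_exprz q id z0)
  (gaussian_bound_qexprz q (fun n : int => n ^+ 2)).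
apply: (gaussian_boundW q0 q1 (K := 2) (gaussian_boundM q0 h h)) => s _ /=.
by lia.
Qed.

Lemma bailey_pair_layer al be : bailey_pair al be ->
  exists2 be', forall N, has_sum (fun s => u s ^+ 2 * iQ (N - s) * be s : C) (be' N) &
    bailey_pair (fun n => u n ^+ 2 * al n) be'.
Proof.
move=> hab; have [hal _] := hab.
have hv N : weight_bound (fun s => u s ^+ 2 * iQ (N - s)).
  apply: (gaussian_boundW q0 q1 (K := 1) (gaussian_boundM q0
    gaussian_bound_theta_weight_sqr (gaussian_bound_comp (fun s => N - s)
    (gaussian_bound_inv_qfact q0 q1)))) => s _ /=.
  by have /andP[] := neg_sqr_itv s; lia.
have /choice [be' hbe'] N := bailey_pair_exchange hab (hv N) (fun n =>
  @bailey_kernel_layer C q z q0 z0 z2_regular (qbase_not_root q1) N n).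
exists be' => [N|]; first by have [] := hbe' N.
split=> [|N].
  apply: (gaussian_boundW q0 q1 (K := 2) (gaussian_boundM q0
    gaussian_bound_theta_weight_sqr hal)) => n _ /=.
  by have := sqr_ge0 n; lia.
by have [_] := hbe' N; apply: eq_has_sum => n; rewrite mulrA [al n * _]mulrC.
Qed.

Lemma alpha_bound_pred g : alpha_bound g -> alpha_bound (fun n => g (n - 1)).
Proof.
move=> hg.
apply: (gaussian_boundW q0 q1 (K := 10) (gaussian_bound_comp (fun n => n - 1) hg)).
by move=> n _ /=; rewrite !expr2; lia.
Qed.

Lemma has_sum_kernel_row al N : alpha_bound al ->
  exists t, has_sum (fun n => al n * ker N n : C) t.
Proof.
move=> hal; have h := gaussian_boundM q0 hal
  (gaussian_bound_comp (fun n => (n, N)) gaussian_kernel).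
have {}h : gaussian_bound q absz (fun n => n ^+ 2) (fun n => al n * ker N n).
  set K := (2 * (absz N * absz N) + absz N + 2)%N.
  have KE : K%:Z = 2 * N ^+ 2 + (absz N)%:Z + 2 by rewrite /K; lia.
  apply: (gaussian_boundW q0 q1 (K := K) h) => n _ /=; split; first by nia.
  have := sqr_ge0 (N - n).
  have := mulr_ge0 (ler0n _ K) (ler0n _ (absz n) : 0 <= _ :> int).
  have := neg_sqr_itv (N + n); rewrite !natz KE !expr2 => /andP[]; lia.
by apply: (gaussian_bound_has_sum q0 q1 (K := 1) _ h) => // n _; rewrite mul1r.
Qed.

(* [Q^s beta_s]: a summation by parts in [n]. *)
Lemma bailey_pair_qshift g be : alpha_bound g ->
  bailey_pair (qdiff q z g) be ->
  bailey_pair (fun n => Q ^ n * g n - Q ^ (n - 1) * g (n - 1)) (fun s => Q ^ s * be s).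
Proof.
move=> hg [_ hbe]; have hQg := gaussian_bound_exprzM q0 q1 Q0 hg.
split=> [|s]; first exact: (gaussian_boundB q0 q1 hQg (alpha_bound_pred hQg)).
have [t ht] : exists t, has_sum (fun n => (Q ^ n - Q ^ s) * g n * ker s n : C) t.
  apply: has_sum_kernel_row.
  apply: eq_gaussian_bound (gaussian_boundB q0 q1 hQg (gaussian_boundZ q0 q1 (Q ^ s) hg)).
  by move=> n; rewrite mulrBl.
have := has_sum_telescope (has_sumZ (Q ^ s) (hbe s)) (has_sum_shift (-1) ht).
apply: eq_has_sum => n; rewrite bailey_kernel_telescope ?addrK //.
exact: qbase_not_root.
Qed.

End BaileyPairs.

(** * Multiple sums *)

Section TupleSums.
Variable R : realType.
Local Notation C := (R[i] : numFieldType).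

Lemma bounded_sumsD (I : choiceType) (b c : I -> R) :
  bounded_sums b -> bounded_sums c -> bounded_sums (fun i => b i + c i).
Proof. by move=> [B bB] [D cD]; exists (B + D) => F; rewrite big_split lerD. Qed.

Lemma tuple_split_inj (I : Type) m :
  injective (fun k : m.+1.-tuple I => (thead k, behead_tuple k)).
Proof.
move=> k l [hd tl]; rewrite (tuple_eta k) (tuple_eta l) hd.
by apply: val_inj; rewrite /= tl.
Qed.

Lemma bounded_sums_tuple (I : choiceType) (b : I -> R) m :
  (forall i, 0 <= b i) -> bounded_sums b ->
  bounded_sums (fun k : m.-tuple I => \prod_(i <- k) b i).
Proof.
move=> b0 hb; elim: m => [|m IH].
  exists (\sum_(k <- [fset [tuple] : 0.-tuple I]) \prod_(i <- k) b i) => F.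
  apply: ler_sum_fset => [k|]; first exact: prodr_ge0.
  by apply/fsubsetP => k _; rewrite tuple0 inE.
have prod_ge0 (k : m.-tuple I) : 0 <= \prod_(i <- k) b i by apply: prodr_ge0.
apply: bounded_sums_le (bounded_sums_inj (@tuple_split_inj I m)
  (bounded_sumsM b0 prod_ge0 hb IH)) => k.
by rewrite {1}(tuple_eta k) big_cons.
Qed.

Lemma has_sum_tupleS (I : choiceType) m (b : m.+1.-tuple I -> R)
    (f : m.+1.-tuple I -> C) (g : I -> C) s :
  bounded_sums b -> (forall k, normc (f k) <= b k) ->
  (forall i, has_sum (fun k : m.-tuple I => f [tuple of i :: k]) (g i)) ->
  has_sum g s -> has_sum f s.
Proof.
move=> hb fb hg hs; have [t ht] := dominated_has_sum hb fb.
suff -> : s = t by [].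
have := has_sum_reindex_bij (h := fun p : I * m.-tuple I => [tuple of p.1 :: p.2])
  (h' := fun k => (thead k, behead_tuple k)) _ _ ht.
move=> ht'; apply: has_sum_unique hs (has_sum_iter (ht' _ _) hg).
  by case=> i k; rewrite theadE; congr (_, _); apply: val_inj.
by move=> k; rewrite [RHS]tuple_eta; apply: val_inj.
Qed.

End TupleSums.

Section MultiSum.
Variables (R : realType) (q z : R[i]).
Hypotheses (q0 : q != 0) (q1 : normc q < 1) (z0 : z != 0).
Local Notation C := (R[i] : numFieldType).
Local Notation Q := (q ^+ 2).
Hypothesis z2_regular : qregular Q (z ^+ 2).
Local Notation iQ := (inv_qfact q).
Local Notation u := (theta_weight q z).

Let Q0 : Q != 0. Proof. exact: qbase_neq0. Qed.

Variables i r : nat.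
Local Notation lin := (linear_factor q i).
Local Notation chain := (chain q z i).
Local Notation chain_alpha := (chain_alpha q z i r).

Lemma linear_factor_bailey_pair j be : (j < r)%N ->
  bailey_pair q z (chain_alpha j.+1) be ->
  exists2 al, bailey_pair q z al (fun s => lin j s * be s) &
    chain_alpha j = fun n => u n ^+ 2 * al n.
Proof.
move=> jr hab; have [ij|ji] := leqP i j; last first.
  exists (chain_alpha j.+1).
    rewrite (_ : (fun s => _) = be) //; apply/funext => s.
    by rewrite /linear_factor leqNgt ji mul1r.
  apply/funext => n; rewrite /chain_alpha mulrA -exprD.
  by congr (_ ^+ _ * qdiff _ _ (level _ _ _) _); lia.
have [m mE] : exists m : nat, (r - j.+1)%N = m by exists (r - j.+1)%N.
have alphaE k : (i <= k)%N -> chain_alpha k = qdiff q z (level q z (r - k)%N).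
  move=> ik; apply/funext => n; rewrite /chain_alpha (eqP ik : i - k = 0)%N mul1r.
  by rewrite (maxn_idPr ik).
rewrite (alphaE _ (leqW ij)) mE in hab; rewrite (alphaE _ ij).
have hlevel := alpha_bound_level q0 q1 z0 m.
exists (fun n => Q ^ n * level q z m n - Q ^ (n - 1) * level q z m (n - 1)).
  have := bailey_pair_qshift q0 q1 z0 z2_regular hlevel hab.
  by rewrite /linear_factor ij.
apply/funext => n; rewrite (_ : (r - j)%N%:Z = m%:Z + 1); last by lia.
exact/esym/qdiff_levelS.
Qed.

Lemma chain_alpha_step j be : (j < r)%N -> bailey_pair q z (chain_alpha j.+1) be ->
  exists2 be', forall N, has_sum (fun s => u s ^+ 2 * iQ (N - s) * (lin j s * be s) : C)
      (be' N) & bailey_pair q z (chain_alpha j) be'.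
Proof.
move=> jr /(linear_factor_bailey_pair jr) [al hal ->].
exact: bailey_pair_layer.
Qed.

Definition tail_majorant (A M : R) (N : int) : R :=
  A * M ^+ absz N * normc q ^ (- neg_sqr N).

Lemma weighted_majorant_bounded (v : int -> R[i]) (A M : R) : 0 <= A -> 1 <= M ->
  weight_bound q v ->
  bounded_sums (fun s => normc (v s) * tail_majorant A M s).
Proof.
move=> A0 M1 [B [N [B0 N1 vB]]].
have [D D0 hD] := geometric_le_gaussian q1 (K := 1) isT (mulr_ege1 M1 N1).
have M0 : 0 <= M by apply: le_trans M1.
apply: bounded_sums_le
  (bounded_sumsZ (mulr_ge0 (mulr_ge0 A0 B0) D0) (bounded_sums_half R)) => s.
have rho0 := normc_ge0 q.
apply: (@le_trans _ _ (B * N ^+ absz s * normc q ^ (s ^+ 2 + neg_sqr s)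
    * tail_majorant A M s)).
  by rewrite ler_wpM2r // !mulr_ge0 ?exprn_ge0 ?exprz_ge0.
rewrite [leLHS](_ : _ = A * B * ((M * N) ^+ absz s * normc q ^+ (absz s ^ 2))).
  by rewrite -!mulrA !ler_wpM2l // hD // mul1n.
have -> : normc q ^+ (absz s ^ 2)
    = normc q ^ (s ^+ 2 + neg_sqr s) * normc q ^ (- neg_sqr s).
  rewrite -expfzDr ?addrK ?gt_eqF ?normc_gt0 // exprnP; congr (_ ^ _).
  by rewrite -abszX gez0_abs ?sqr_ge0.
by rewrite /tail_majorant exprMn; ring.
Qed.

Lemma tail_majorant_ge1 (A M : R) N : 1 <= A -> 1 <= M -> 1 <= tail_majorant A M N.
Proof.
move=> A1 M1; rewrite /tail_majorant !mulr_ege1 ?exprn_ege1 //.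
rewrite -(expr0z (normc q)) normc_exprz_le // oppr_le0.
by case/andP: (neg_sqr_itv N).
Qed.

Definition layer_majorant (A M : R) (s : int) : R :=
  (normc (u s ^+ 2) + normc (Q ^ s * u s ^+ 2)) * tail_majorant A M s.

Lemma bounded_sums_layer_majorant (A M : R) : 0 <= A -> 1 <= M ->
  bounded_sums (layer_majorant A M).
Proof.
move=> A0 M1; have hu := gaussian_bound_theta_weight_sqr q0 q1 z0.
apply: bounded_sums_le (bounded_sumsD
  (weighted_majorant_bounded (v := fun s => u s ^+ 2) A0 M1 _)
  (weighted_majorant_bounded (v := fun s => Q ^ s * u s ^+ 2) A0 M1 _)) => [s||].
- by rewrite -mulrDl.
- apply: (gaussian_boundW q0 q1 (K := 1) hu) => s _ /=.
  by have /andP[] := neg_sqr_itv s; lia.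
apply: (gaussian_boundW q0 q1 (K := 1) (gaussian_bound_exprzM q0 q1 Q0 hu)) => s _ /=.
by have /andP[] := neg_sqr_itv s; lia.
Qed.

Lemma layer_majorant_ge (A M : R) j s : 0 <= tail_majorant A M s ->
  normc (u s ^+ 2 * lin j s) * tail_majorant A M s <= layer_majorant A M s.
Proof.
move=> tail0; rewrite ler_wpM2r // /linear_factor.
by case: ifP => _; rewrite ?mulr1 ?lerDl ?normc_ge0 // mulrC lerDr normc_ge0.
Qed.

Lemma chain_le_prod : exists A M b, [/\ 1 <= A, 1 <= M, forall s, 0 <= b s,
  bounded_sums b & forall j N k,
    normc (chain j N k) <= tail_majorant A M N * \prod_(s <- k) b s].
Proof.
have zQ0 : z * Q != 0 by rewrite mulf_neq0.
have zQ_regular := qregularM Q0 1 (qregular_sqr Q0 z2_regular).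
have [A [M [A0 M1 hA]]] := gaussian_bound_qpochV q0 q1 zQ0 zQ_regular.
have [D hD] := inv_qfact_bounded q0 q1.
have D0 : 0 <= D by apply: le_trans (hD 0); apply: normc_ge0.
have A1 : 1 <= 1 + A by rewrite lerDl.
have tail1 N : 1 <= tail_majorant (1 + A) M N by rewrite tail_majorant_ge1.
have tail0 N : 0 <= tail_majorant (1 + A) M N by apply: le_trans (tail1 N).
have layer0 s : 0 <= layer_majorant (1 + A) M s.
  by rewrite mulr_ge0 // addr_ge0 ?normc_ge0.
exists (1 + A), M, (fun s => D * layer_majorant (1 + A) M s); split=> // [s||j N k].
- by rewrite mulr_ge0.
- by apply/bounded_sumsZ/bounded_sums_layer_majorant; rewrite ?addr_ge0.
elim: k j N => [|s k IH] j N /=.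
  rewrite big_nil mulr1 (le_trans (hA N)) // /tail_majorant.
  rewrite ler_wpM2r ?exprz_ge0 ?normc_ge0 // ler_wpM2r ?exprn_ge0 ?lerDr //.
  exact: le_trans M1.
rewrite big_cons; set P := \prod_(i <- k) _.
have P0 : 0 <= P by apply: prodr_ge0 => t _; rewrite mulr_ge0.
apply: (@le_trans _ _ (D * (layer_majorant (1 + A) M s * P))); last first.
  by rewrite mulrA ler_peMl // mulr_ge0 // mulr_ge0.
rewrite normcM ler_pM ?normc_ge0 // normcM.
rewrite (le_trans (ler_wpM2l (normc_ge0 _) (IH j.+1 s))) // mulrA.
by rewrite ler_wpM2r // layer_majorant_ge.
Qed.

Lemma chain_majorant m (v : int -> R[i]) j :
  weight_bound q v -> exists2 b, bounded_sums b &
    forall k : m.+1.-tuple int,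
      normc (v (thead k) * chain j (thead k) (behead k)) <= b k.
Proof.
move=> hv; have [A [M [b [A1 M1 b0 hb chain_le]]]] := chain_le_prod.
have A0 : 0 <= A by apply: le_trans A1.
have hvt := weighted_majorant_bounded A0 M1 hv.
have tail0 s : 0 <= tail_majorant A M s.
  by rewrite (le_trans _ (tail_majorant_ge1 s A1 M1)).
have vt0 s : 0 <= normc (v s) * tail_majorant A M s by rewrite mulr_ge0 ?normc_ge0.
have prod_ge0 (k : m.-tuple int) : 0 <= \prod_(s <- k) b s by apply: prodr_ge0.
exists (fun k => normc (v (thead k)) * tail_majorant A M (thead k)
   * \prod_(s <- behead k) b s).
  have := bounded_sums_inj (@tuple_split_inj int m)
    (bounded_sumsM vt0 prod_ge0 hvt (bounded_sums_tuple m b0 hb)).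
  exact.
by move=> k; rewrite normcM -mulrA ler_wpM2l ?normc_ge0.
Qed.

Lemma gaussian_bound_linear_factor j : gaussian_bound q absz (fun=> 0) (lin j).
Proof.
rewrite /linear_factor; case: leqP => _; first exact: (gaussian_bound_exprz q id Q0).
apply: (gaussian_boundW q0 q1 (K := 1) (@bounded_gaussian_bound _ q _ (fun=> 1) 1 _)).
  by move=> s; rewrite normc1.
by move=> s _; rewrite add0r addr_ge0 ?mulr_ge0.
Qed.

Lemma weight_bound_chain_weight j N :
  weight_bound q (fun s => iQ (N - s) * (u s ^+ 2 * lin j s)).
Proof.
apply: (gaussian_boundW q0 q1 (K := 2) (gaussian_boundM q0
  (gaussian_bound_comp (fun s => N - s) (gaussian_bound_inv_qfact q0 q1))
  (gaussian_boundM q0 (gaussian_bound_theta_weight_sqr q0 q1 z0)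
    (gaussian_bound_linear_factor j)))) => s _ /=.
by have /andP[] := neg_sqr_itv s; lia.
Qed.

Definition base_constant : R[i] := qpoch_inf z^-1 Q / qpoch_inf (z ^- 2) Q.

Lemma chain_sum m : (m < r)%N -> (i <= r)%N ->
  exists2 be, bailey_pair q z (chain_alpha (r - m)) be &
    forall N, has_sum (fun k : m.-tuple int => chain (r - m) N k : C)
      (base_constant * be N).
Proof.
move=> mr ir; elim: m mr => [|m IH] mr.
  have zV_regular : qregular Q z^-1 by apply/qregularV/qregular_sqr.
  have z2V_regular : qregular Q (z ^- 2) by apply: qregularV.
  exists (fun N => qpoch_inf (z ^- 2) Q / qpoch_inf z^-1 Q / qpoch (z * Q) Q N) => [|N].
    rewrite (_ : chain_alpha (r - 0) = qdiff q z (level q z 0)); last first.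
      apply/funext => n; rewrite /chain_alpha subn0 (eqP ir : i - r = 0)%N mul1r.
      by rewrite (maxn_idPr ir) subnn.
    exact: base_bailey_pair.
  rewrite (_ : base_constant * _ = chain (r - 0) N [tuple]).
    by apply: has_sum_single => k; rewrite tuple0 eqxx.
  have Q1 := normc_qbase_lt1 q1.
  rewrite /base_constant /= -invf_div mulrA mulVf ?mul1r //.
  by rewrite mulf_neq0 ?invr_eq0 ?qpoch_inf_neq0 // => j; apply: qregular_nat.
have [be hbe chain_be] := IH (ltnW mr).
have jE : (r - m = (r - m.+1).+1)%N by lia.
set j := (r - m.+1)%N in jE *; rewrite jE in hbe chain_be.
have [|be' step_be' hbe'] := chain_alpha_step _ hbe; first by rewrite /j; lia.
exists be' => [|N]; first exact: hbe'.
have [b hb chain_b] := chain_majorant m j.+1 (weight_bound_chain_weight j N).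
apply: (has_sum_tupleS hb (g := fun s =>
  iQ (N - s) * (u s ^+ 2 * lin j s) * (base_constant * be s))).
- by move=> k; rewrite {1}(tuple_eta k) /= mulrA.
- by move=> s; apply: eq_has_sum (has_sumZ _ (chain_be s)) => k; rewrite /= [RHS]mulrA.
apply: eq_has_sum (has_sumZ base_constant (step_be' N)) => s.
by ring.
Qed.

End MultiSum.

Section ThetaSeries.
Variables (R : realType) (q z : R[i]).
Hypotheses (q0 : q != 0) (q1 : normc q < 1) (z0 : z != 0).
Local Notation C := (R[i] : numFieldType).
Variable r : nat.
Hypothesis r0 : (0 < r)%N.

Lemma theta_term_sum (c c' : int) : c + c' = 4 * r%:Z ->
  has_sum (theta_term q z r c : int -> C) (qpoch_inf (q ^+ (4 * r)) (q ^+ (4 * r)) *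
    qpoch_inf2 (z ^+ (2 * r) * q ^ c) (z ^- (2 * r) * q ^ c') (q ^+ (4 * r))).
Proof.
move=> cc'; set p := q ^+ (2 * r); set x := z ^+ (2 * r) * q ^ c.
have p0 : p != 0 by rewrite expf_neq0.
have p1 : normc p < 1 by rewrite normcX exprn_ilt1 ?normc_ge0 // muln_eq0 /= -lt0n.
have x0 : x != 0 by rewrite mulf_neq0 ?expf_neq0 ?expfz_neq0.
have pE : q ^+ (4 * r) = p ^+ 2 by rewrite -exprM; congr (_ ^+ _); lia.
have xE : z ^- (2 * r) * q ^ c' = p ^+ 2 / x.
  rewrite -pE (exprnP q (4 * r)) (_ : (4 * r)%N%:Z = c' + c); last by lia.
  by rewrite (expfzDr _ _ q0) /x invfM mulrCA mulfK ?expfz_neq0.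
rewrite xE pE /qpoch_inf2.
by apply: eq_has_sum (jacobi_triple_product p0 p1 x0) => n.
Qed.

Definition theta_value (i : nat) : C :=
  qpoch_inf (q ^+ (4 * r)) (q ^+ (4 * r)) *
  (qpoch_inf2 (z ^+ (2 * r) * q ^ (4 * r%:Z + 1 - 2 * i%:Z))
     (z ^- (2 * r) * q ^ (2 * i%:Z - 1)) (q ^+ (4 * r))
   + z ^ (2 * i%:Z - 1 - 2 * r%:Z)
     * qpoch_inf2 (z ^+ (2 * r) * q ^ (2 * i%:Z - 1))
         (z ^- (2 * r) * q ^ (4 * r%:Z + 1 - 2 * i%:Z)) (q ^+ (4 * r))).

Lemma theta_pair_sum i : has_sum (theta_pair q z i r : int -> C) (theta_value i).
Proof.
rewrite /theta_value mulrDr [X in _ + X]mulrCA.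
by apply: has_sumD; last apply: has_sumZ; apply: theta_term_sum; ring.
Qed.

End ThetaSeries.

Section FullSum.
Variables (R : realType) (q z : R[i]).
Hypotheses (q0 : q != 0) (q1 : normc q < 1) (z0 : z != 0).
Local Notation C := (R[i] : numFieldType).
Local Notation Q := (q ^+ 2).
Hypothesis z2_regular : qregular Q (z ^+ 2).
Hypothesis zq_wd : forall s, qpoch_wd (- z * q) Q s.
Local Notation u := (theta_weight q z).
Local Notation outer := (outer_weight q z).

Lemma weight_bound_outer_weight : weight_bound q outer.
Proof.
have zq0 : - z * q != 0 by rewrite mulf_neq0 ?oppr_eq0.
apply: (gaussian_boundW q0 q1 (K := 2) (gaussian_boundM q0
  (gaussian_bound_qpoch q0 q1 zq0 zq_wd) (gaussian_boundM q0
    (gaussian_bound_exprz q id z0) (gaussian_bound_qexprz q (fun n : int => n ^+ 2))))) => s _ /=.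
by lia.
Qed.

Lemma outer_chain_sum m i : (1 <= i <= m.+2)%N ->
  has_sum (fun k : m.+1.-tuple int => outer (thead k)
      * linear_factor q i 1 (thead k) * chain q z i 2 (thead k) (behead k) : C)
    (qpoch_inf (- z * q) Q / qpoch_inf (z ^+ 2 * Q) Q * base_constant q z
     * theta_value q z m.+2 i).
Proof.
move=> /andP[i1 ir]; set E := _ / _.
have [|//|be hbe chain_be] := @chain_sum R q z q0 q1 z0 z2_regular i m.+2 m; first by lia.
rewrite (_ : m.+2 - m = 2)%N in hbe chain_be; last by lia.
have [//|al hal alpha1] := linear_factor_bailey_pair q0 q1 z0 z2_regular _ hbe.
have [|S [hS1 hS2]] := bailey_pair_exchange q0 q1 z0 z2_regular hal
  weight_bound_outer_weight (la := fun n => E * u n).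
  by move=> n; apply: outer_weight_sum.
have S_theta : S = E * theta_value q z m.+2 i.
  apply: has_sum_unique hS2 _.
  apply: eq_has_sum (has_sumZ E (@theta_pair_sum R q z q0 q1 z0 m.+2 isT i)) => n.
  have theta_pairE : theta_pair q z i m.+2 n = u n * al n.
    apply: (mulfI (theta_weight_neq0 q0 z0 n)).
    by rewrite -chain_alpha1 ?i1 // alpha1 [RHS]mulrA.
  by rewrite theta_pairE mulrA [LHS]mulrC.
have houter : weight_bound q (fun s => outer s * linear_factor q i 1 s).
  apply: (gaussian_boundW q0 q1 (K := 2) (gaussian_boundM q0 weight_bound_outer_weight
    (gaussian_bound_linear_factor q0 q1 i 1))) => s _ /=.
  by lia.
have [b hb chain_b] := chain_majorant q0 q1 z0 z2_regular i m 2 houter.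
apply: (has_sum_tupleS hb chain_b (g := fun s => outer s * linear_factor q i 1 s
  * (base_constant q z * be s))) => [s|].
  exact: has_sumZ (chain_be s).
have -> : E * base_constant q z * theta_value q z m.+2 i = base_constant q z * S.
  by rewrite S_theta [RHS]mulrCA [RHS]mulrA.
apply: eq_has_sum (has_sumZ (base_constant q z) hS1) => s.
by rewrite [RHS]mulrCA; congr (_ * _); apply: mulrA.
Qed.

End FullSum.

Lemma qregular_qpoch_inf (R : realType) (Q x : R[i]) : Q != 0 -> normc Q < 1 ->
  x != 0 -> qpoch_inf (x * Q) Q != 0 -> qpoch_inf x^-1 Q != 0 -> qregular Q x.
Proof.
move=> Q0 Q1 x0 xQ_neq0 xV_neq0 n.
have [n0|n0] := ltP 0 n.
  apply: contra_neq xQ_neq0 => xn; apply: (@qpoch_inf_eq0_factor _ _ Q1 _ (absz n).-1).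
  by rewrite -mulrA -exprS exprnP (_ : (absz n).-1.+1%:Z = n) //; lia.
apply: contra_neq xV_neq0 => /eqP; rewrite subr_eq0 => /eqP xn.
apply: (@qpoch_inf_eq0_factor _ _ Q1 _ (absz n)).
have -> : Q ^+ absz n = (Q ^ n)^-1 by rewrite invr_expz exprnP; congr (_ ^ _); lia.
by rewrite -invfM -xn invr1 subrr.
Qed.

Lemma outer_qpoch_wd (F : fieldType) (q z : F) m : q != 0 -> z != 0 ->
  (forall k : Lambda m.+1,
    qpoch_wd (- q ^ (1 - 2 * part k 1) / z) (q ^+ 2) (part k 1)) ->
  forall s, qpoch_wd (- z * q) (q ^+ 2) s.
Proof.
move=> q0 z0 wd s.
have const_sorted : sorted >=%R (nseq_tuple m.+1 s).
  by rewrite /=; elim: m {wd} => //= m ->; rewrite lexx.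
have := wd (exist (fun k : m.+1.-tuple int => sorted >=%R k) _ const_sorted).
rewrite /part /=; set x := _ / z => wd_s.
have x0 : x != 0 by rewrite mulf_neq0 ?invr_eq0 ?oppr_eq0 ?expfz_neq0.
have := qpoch_wd_reverse q0 x0 wd_s.
rewrite (_ : q ^ _ / x = - z * q) // /x (_ : 2 - 2 * s = 1 - 2 * s + 1); last by ring.
rewrite (expfzDr _ 1 q0) expr1z; have := expfz_neq0 (1 - 2 * s) q0.
by move: (q ^ _) => a a0; field; rewrite z0 oppr_eq0 a0.
Qed.

Theorem theorem4p8 (R : realType) (r i : nat) (q z : R[i])
  (hr : (2 <= r)%N) (hi : (1 <= i <= r)%N)
  (hq : `|q| < 1) (hq0 : q != 0) (hz : z != 0)
  (hwd1 : forall k : Lambda r.-1,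
    qpoch_wd (- q ^ (1 - 2 * part k 1) / z) (q ^+ 2) (part k 1))
  (hwd2 : forall k : Lambda r.-1,
    qpoch_wd (z * q ^+ 2) (q ^+ 2) (part k r.-1))
  (hdenl : forall k : Lambda r.-1,
    qpoch (z * q ^+ 2) (q ^+ 2) (part k r.-1)
    * \prod_(1 <= j < r.-1)
        qpoch (q ^+ 2) (q ^+ 2) (part k j - part k j.+1) != 0)
  (hdenr : qpoch_inf2 (z ^+ 2 * q ^+ 2) (1 / z ^+ 2) (q ^+ 2) != 0) :
  has_sum
    (fun k : Lambda r.-1 =>
       qpoch (- q ^ (1 - 2 * part k 1) / z) (q ^+ 2) (part k 1)
       * q ^ (2 * (\sum_(1 <= j < r) part k j ^+ 2)
              + 2 * (\sum_(i <= j < r) part k j))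
       / (qpoch (z * q ^+ 2) (q ^+ 2) (part k r.-1)
          * \prod_(1 <= j < r.-1)
              qpoch (q ^+ 2) (q ^+ 2) (part k j - part k j.+1))
       * z ^ (2 * (\sum_(1 <= j < r) part k j)))
    (qpoch_inf2 (- z * q) (1 / z) (q ^+ 2)
     / qpoch_inf2 (z ^+ 2 * q ^+ 2) (1 / z ^+ 2) (q ^+ 2)
     * qpoch_inf (q ^+ (4 * r)) (q ^+ (4 * r))
     * (qpoch_inf2 (z ^+ (2 * r) * q ^ (4 * r%:Z + 1 - 2 * i%:Z))
                   (z ^- (2 * r) * q ^ (2 * i%:Z - 1)) (q ^+ (4 * r))
        + z ^ (2 * i%:Z - 1 - 2 * r%:Z)
          * qpoch_inf2 (z ^+ (2 * r) * q ^ (2 * i%:Z - 1))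
                       (z ^- (2 * r) * q ^ (4 * r%:Z + 1 - 2 * i%:Z))
                       (q ^+ (4 * r)))).
Proof.
have q1 : normc q < 1 by rewrite -ltcR -normcE.
case: r hr hi hwd1 hwd2 hdenl => [|[|m]] // _ hi hwd1 _ _.
have Q0 := qbase_neq0 hq0; have Q1 := normc_qbase_lt1 q1.
have zq_wd := outer_qpoch_wd hq0 hz hwd1.
move: hdenr; rewrite !div1r {1}/qpoch_inf2 mulf_eq0 negb_or => /andP[z2Q_neq0 z2V_neq0].
have z2_regular := qregular_qpoch_inf Q0 Q1 (expf_neq0 2 hz) z2Q_neq0 z2V_neq0.
have := has_sum_reindex (h := val : Lambda m.+1 -> _) (h' := insub) valK (insubK _) _
  (outer_chain_sum hq0 q1 hz z2_regular zq_wd hi).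
rewrite {1}/base_constant mulf_div => sum_sorted.
rewrite -mulrA; apply: eq_has_sum (sum_sorted _) => [[K sK]|K].
  case/tupleP: K sK => s k sK /=; set A := qpoch _ _ s.
  have summandE := summand_chain hq0 hz A s k (proj1 (andP hi)).
  by rewrite size_tuple outer_weightE // in summandE; rewrite theadE -[LHS]summandE.
case: insubP => // not_sorted _; apply/eqP; apply: contraNT not_sorted.
by rewrite mulf_eq0 negb_or => /andP[_ /(chain_path hq0)]; rewrite {3}(tuple_eta K).
Qed.
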